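(* Let $d\ge2$ and let $E\subset\mathbb{R}^d$ be a compact set with $\dim_{\mathcal H}(E)>d-1$. Then every positive real number is the radius of a sphere determined by $E$; that is, for every $r>0$ there exist $x^1,\dots,x^{d+1}\in E$ with $R(x^1,\dots,x^{d+1})=r$.
   Context: $\dim_{\mathcal H}$ denotes Hausdorff dimension. A ($(d-1)$-dimensional) sphere in $\mathbb{R}^d$ is determined by a $(d+1)$-tuple $(x^1,\dots,x^{d+1})$ of points of $\mathbb{R}^d$ if it is the unique sphere passing through all of the points $x^1,\dots,x^{d+1}$; it is determined by a set $E$ if it is determined by some $(d+1)$-tuple in $E\times\cdots\times E$. $R(x^1,\dots,x^{d+1})$ denotes the radius of the $(d-1)$-dimensional sphere determined by $(x^1,\dots,x^{d+1})$, and $R(x^1,\dots,x^{d+1})=0$ if such a sphere does not exist or is not unique. *)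

(* Defs.v *)
From mathcomp Require Import all_boot all_order all_algebra.
From mathcomp Require Import all_classical all_reals all_analysis.

Set Implicit Arguments.
Unset Strict Implicit.
Unset Printing Implicit Defensive.

Import Order.TTheory GRing.Theory Num.Theory.
Import numFieldNormedType.Exports.

Local Open Scope classical_set_scope.
Local Open Scope ring_scope.

(* The library norm on 'rV[R]_d is the sup norm, hence the explicit Euclidean
   distance.  The topology of 'rV[R]_d (used by [compact]) is the product
   topology, that is, the Euclidean one. *)
Definition edist (R : realType) (d : nat) (x y : 'rV[R]_d) : R :=
  Num.sqrt (\sum_(i < d) (x ord0 i - y ord0 i) ^+ 2).

(* The point 0 is added because ereal_sup set0 = -oo, whereas the diameter of
   the empty set is 0. *)
Definition diameter (R : realType) (d : nat) (U : set 'rV[R]_d) : \bar R :=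
  ereal_sup ([set 0%E] `|` [set (edist x y)%:E | x in U & y in U]).

(* The power diam(U)^s.  As 0 `^ 0 = 1, a nonempty set has diam(U)^0 = 1; the
   empty set must contribute 0 also when s = 0. *)
Definition diameter_pow (R : realType) (d : nat) (s : R) (U : set 'rV[R]_d) :
    \bar R :=
  if U == set0 then 0%E else poweR (diameter U) s.

Definition hausdorff_premeasure (R : realType) (d : nat) (s delta : R)
    (E : set 'rV[R]_d) : \bar R :=
  ereal_inf [set z : \bar R | exists U : nat -> set 'rV[R]_d,
    [/\ E `<=` \bigcup_n U n,
        forall n, (diameter (U n) <= delta%:E)%E &
        z = (\sum_(0 <= n <oo) diameter_pow s (U n))%E]].

(* The supremum over delta > 0 is the limit as delta tends to 0, since the
   premeasure is nonincreasing in delta. *)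
Definition hausdorff_measure (R : realType) (d : nat) (s : R)
    (E : set 'rV[R]_d) : \bar R :=
  ereal_sup [set hausdorff_premeasure s delta E | delta in [set t : R | 0 < t]].

Definition hausdorff_dim (R : realType) (d : nat) (E : set 'rV[R]_d) : \bar R :=
  ereal_inf [set s%:E | s in [set s : R | 0 <= s /\ hausdorff_measure s E = 0%E]].

Definition sphere (R : realType) (d : nat) (c : 'rV[R]_d) (r : R) :
    set 'rV[R]_d :=
  [set x | edist x c = r].

(* Spheres are nondegenerate: points (radius 0) are not (d-1)-dimensional. *)
Definition is_sphere (R : realType) (d : nat) (S : set 'rV[R]_d) : Prop :=
  exists c r, 0 < r /\ S = sphere c r.

Definition determined_by (R : realType) (d : nat) (S : set 'rV[R]_d)
    (x : 'I_d.+1 -> 'rV[R]_d) : Prop :=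
  [/\ is_sphere S, forall i, S (x i) &
      forall S', is_sphere S' -> (forall i, S' (x i)) -> S' = S].

(* xget picks the (unique, for d >= 1) element of the set, and returns 0 when
   the set is empty. *)
Definition sphere_radius (R : realType) (d : nat) (x : 'I_d.+1 -> 'rV[R]_d) :
    R :=
  xget 0 [set r : R | 0 < r /\ exists c, determined_by (sphere c r) x].

(* Main.v *)
Require Import Defs.
From mathcomp Require Import all_boot all_order all_algebra.
From mathcomp Require Import all_classical all_reals all_analysis.
From mathcomp Require Import zify ring lra.

Import Order.TTheory GRing.Theory Num.Theory.
Import numFieldNormedType.Exports.

Set Implicit Arguments.
Unset Strict Implicit.
Unset Printing Implicit Defensive.

Local Open Scope ring_scope.

(** Fix [s] with [d - 1 < s < dim E].  At scale [l0 / 2 ^ n] a discrete Frostman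
    lemma gives a weight on finitely many points of [E], of total mass bounded
    below, for which a dyadic cube of side [l0 / 2 ^ m] has mass at most
    [q ^ m], [q = 2 ^ (- s)].  For [z] in a grid of side [l0] and mesh
    [l0 / 2 ^ n], distribute the points [x] into buckets according to the height
    [x i0 + sqrt (r^2 - |x' - z'|^2)] of the centre, lying above [z'], of the
    sphere of radius [r] through [x].  Two points at distance [D] share a bucket
    for a proportion [O(2 ^ - n / D)] of the [z] only, because the difference
    of their heights moves with [z] at speed about [D / r].  If every bucket met
    only [N] cubes of side [l0 / 2 ^ k], then Cauchy-Schwarz would bound the
    total mass by [O(N (2 q) ^ k)].  So, for [k] large but fixed, as
    [q < 2 ^ - (d - 1)], some bucket contains more than [C 2 ^ (k (d - 2))]
    points at mutual distance at least [l0 / 2 ^ k].  Letting [n] tend to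
    infinity, compactness of [E] gives as many separated points on an exact
    sphere of radius [r]; a hyperplane section of a sphere is too small to
    contain them all, so [d + 1] of them determine the sphere. *)

(** * Counting lemmas *)

Lemma card_le_fibers (J K : finType) (f : J -> K) (S : {set J}) (M : nat) :
  (forall k, #|[set a in S | f a == k]| <= M)%N -> (#|S| <= #|K| * M)%N.
Proof.
move=> fM; rewrite -sum1_card (partition_big f predT)//=.
rewrite -[X in (_ <= X * _)%N]sum1_card big_distrl/= leq_sum// => k _.
rewrite mul1n (leq_trans _ (fM k))// -sum1_card.
by rewrite [leqRHS](eq_bigl (fun a => (a \in S) && (f a == k)))// => a;
  rewrite inE.
Qed.

Lemma card_ffun_vanishing (I : finType) (M : nat) (D : {set I})
    (S : {set {ffun I -> 'I_M.+1}}) :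
  (forall f i, f \in S -> i \notin D -> f i = ord0) ->
  (#|S| <= M.+1 ^ #|D|)%N.
Proof.
move=> S0; rewrite -[X in (_ <= X ^ _)%N]card_ord -(card_pffun_on ord0).
apply/subset_leq_card/fintype.subsetP => f fS; apply/pffun_onP; split => //.
by apply/fintype.subsetP => i; rewrite inE; apply: contraR => /(S0 _ _ fS) ->.
Qed.

(** Members of [S] with a given residue of [f i] modulo [V.+1] are determined by their values off
    [i]: if two agree there, their values at [i] are congruent and differ by at most [V], hence are
    equal. *)
Lemma card_ffun_gap (I : finType) (N V : nat) (i : I)
    (S : {set {ffun I -> 'I_N}}) :
  (forall f g, f \in S -> g \in S -> (forall j, j != i -> f j = g j) ->
     (f i <= g i + V)%N) ->
  (#|S| <= V.+1 * N ^ #|I|.-1)%N.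
Proof.
case: N S => [|N] S gapS.
  rewrite (@leq_trans 0)// leqn0; apply/eqP/eq_card0 => f.
  by case: (f i).
rewrite -[V.+1]card_ord -(cardsC1 i).
apply: (card_le_fibers (f :=
  fun f : {ffun I -> 'I_N.+1} => inord (f i %% V.+1))) => v.
set A := [set _ in _ | _].
pose h (f : {ffun I -> 'I_N.+1}) := [ffun j => if j == i then ord0 else f j].
rewrite -(@card_in_imset _ _ h); last first.
  move=> f g; rewrite !inE => /andP[fS /eqP fv] /andP[gS /eqP gv] hfg.
  have off j : j != i -> f j = g j.
    by move=> ji; have /ffunP/(_ j) := hfg; rewrite !ffunE (negPf ji).
  apply/ffunP => j; have [->|/off//] := eqVneq j i.
  have := gapS _ _ fS gS off;
    have := gapS _ _ gS fS (fun j ji => esym (off j ji)).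
  have : (f i %% V.+1 = g i %% V.+1)%N.
    have := congr1 (@nat_of_ord _) (etrans fv (esym gv)).
    by rewrite !inordK ?ltn_pmod.
  move=> e1 e2 e3; apply/val_inj => /=.
  wlog : f g fS gS hfg fv gv off e1 e2 e3 / (f i <= g i)%N.
    have [fg|/ltnW gf] := leqP (f i) (g i); first exact.
    move=> /(_ g f gS fS (esym hfg) gv fv)/=-> //.
    by move=> k /off.
  move=> fg; have : (V.+1 %| g i - f i)%N by rewrite -eqn_mod_dvd// e1.
  move=> /dvdnP[c]; case: c => [|c] hc.
    by apply/eqP; rewrite eqn_leq fg -subn_eq0 hc.
  move: hc; rewrite mulSn; move: (c * _)%N {e1} => ? ?; lia.
apply: card_ffun_vanishing => f j /imsetP[g _ ->].
by rewrite !inE negbK /h ffunE => ->.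
Qed.

(** * Packing in a hyperplane section of a sphere *)

Lemma sum_le_card (R : realFieldType) (d : nat) (P : pred 'I_d) (f : 'I_d -> R)
    (t : R) :
  0 <= t -> (forall i, P i -> f i <= t) -> \sum_(i | P i) f i <= d%:R * t.
Proof.
move=> t0 ft; rewrite (le_trans (ler_sum _ ft))// big_mkcond/=.
rewrite (@le_trans _ _ (\sum_(i < d) t))//;
  last by rewrite sumr_const card_ord mulr_natl.
by apply: ler_sum => i _; case: ifP.
Qed.

(* The derivative of the squared Euclidean norm along the hyperplane
   [\sum_i n i * w i = 0], in the coordinates other than [j]. *)
Definition tangent_coord (R : realFieldType) (d : nat) (n : 'I_d -> R)
    (j : 'I_d) (u : 'I_d -> R) (i : 'I_d) : R := u i - n i / n j * u j.

(** With [w = u - v], the hyperplane relation and the equal norms give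
    [\sum_i w i * (G u i + G v i) = 0], where the term at [j] vanishes. The coefficient at [k]
    dominates the others, the equal signs excluding cancellation, so [w k] is controlled by the
    remaining coordinates, and then [w j] by the hyperplane relation. *)
Lemma chord_bound (R : realFieldType) (d : nat) (n u v : 'I_d -> R) (j k : 'I_d)
    (t : R) (G := tangent_coord n j) :
  n j != 0 -> (forall i, `|n i| <= `|n j|) -> k != j ->
  \sum_i n i * (u i - v i) = 0 ->
  \sum_i u i ^+ 2 = \sum_i v i ^+ 2 ->
  (forall i, i != j -> `|G u i| <= `|G u k|) ->
  (forall i, i != j -> `|G v i| <= `|G v k|) ->
  (0 <= G u k) = (0 <= G v k) ->
  0 < t -> (forall i, i != j -> i != k -> `|u i - v i| <= t) ->
  forall i, `|u i - v i| <= d%:R ^+ 2 * t.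
Proof.
move=> nj0 nmax kj nw uv Gu Gv sgn t0 wt.
pose w i := u i - v i; pose nu i := n i / n j.
have nu1 i : `|nu i| <= 1.
  by rewrite normf_div ler_pdivrMr ?normr_gt0// mul1r.
have nuj : nu j = 1 by rewrite /nu divff.
have nuw : \sum_i nu i * w i = 0.
  transitivity ((\sum_i n i * (u i - v i)) / n j); last by rewrite nw mul0r.
  by rewrite mulr_suml; apply: eq_bigr => i _; rewrite /nu /w mulrAC.
have sw : \sum_i w i * (G u i + G v i) = 0.
  transitivity (\sum_i (u i ^+ 2 - v i ^+ 2) - (u j + v j) * \sum_i nu i * w i).
    rewrite mulr_sumr -sumrB; apply: eq_bigr => i _.
    by rewrite /w /G /nu /tangent_coord; ring.
  by rewrite nuw mulr0 subr0 sumrB uv subrr.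
have Gj x : G x j = 0 by rewrite /G /tangent_coord divff// mul1r subrr.
have d1 : 1 <= d%:R :> R by rewrite ler1n (leq_ltn_trans _ (ltn_ord j)).
(* In this degenerate case all tangential coordinates vanish, so [w] is a multiple of [n] as well as
   orthogonal to it, hence zero. *)
have [sk0|sk0] := eqVneq (G u k + G v k) 0.
  have [Guk Gvk] : G u k = 0 /\ G v k = 0.
    by have [] := lerP 0 (G u k); have := sgn; have [] := lerP 0 (G v k); lra.
  have Gu0 i : G u i = 0.
    have [->//|ij] := eqVneq i j.
    by have := Gu _ ij; rewrite Guk normr0 normr_le0 => /eqP.
  have Gv0 i : G v i = 0.
    have [->//|ij] := eqVneq i j.
    by have := Gv _ ij; rewrite Gvk normr0 normr_le0 => /eqP.
  have wE i : w i = nu i * w j.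
    by have := Gu0 i; have := Gv0 i; rewrite /G /tangent_coord /w /nu; lra.
  have wj : w j = 0.
    have : w j * \sum_i nu i ^+ 2 = 0.
      rewrite -[RHS]nuw mulr_sumr; apply: eq_bigr => i _.
      by rewrite [in RHS]wE; ring.
    move/eqP; rewrite mulf_eq0 => /orP[/eqP//|];
      rewrite (bigD1 j)//= nuj => /eqP.
    have : 0 <= \sum_(i | i != j) nu i ^+ 2 by apply: sumr_ge0 => i _;
      exact: sqr_ge0.
    lra.
  move=> i; rewrite -/(w i) wE wj mulr0 normr0 mulr_ge0 ?sqr_ge0//; exact: ltW.
have sle i : i != j -> `|G u i + G v i| <= `|G u k + G v k|.
  move=> ij; rewrite (le_trans (ler_normD _ _))//
    (le_trans (lerD (Gu _ ij) (Gv _ ij)))//.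
  have [gu|gu] := lerP 0 (G u k).
    have gv : 0 <= G v k by rewrite -sgn.
    by rewrite !ger0_norm// addr_ge0.
  have gv : G v k < 0 by rewrite ltNge -sgn -ltNge.
  by rewrite !ltr0_norm//; lra.
have wk : `|w k| <= d%:R * t.
  have : w k * (G u k + G v k) =
      - \sum_(i | (i != j) && (i != k)) w i * (G u i + G v i).
    move: sw; rewrite (bigD1 j)//= !Gj addr0 mulr0 add0r (bigD1 k)//=; lra.
  move=> /(congr1 Num.norm); rewrite normrM normrN => e.
  rewrite -(ler_pM2r (x := `|G u k + G v k|)) ?normr_gt0// e.
  rewrite (le_trans (ler_norm_sum _ _ _))// -mulrA; apply: sum_le_card.
    by rewrite mulr_ge0// ltW.
  move=> i /andP[ij ik]; rewrite normrM ler_pM//; first exact: wt.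
  exact: sle.
have wi i : i != j -> `|w i| <= d%:R * t.
  move=> ij; have [->//|ik] := eqVneq i k.
  by rewrite (le_trans (wt _ ij ik))// ler_peMl// ltW.
have wj : `|w j| <= d%:R ^+ 2 * t.
  have -> : w j = - \sum_(i | i != j) nu i * w i.
    by move: nuw; rewrite (bigD1 j)//= nuj mul1r; lra.
  rewrite normrN (le_trans (ler_norm_sum _ _ _))// expr2 -mulrA;
    apply: sum_le_card.
    by rewrite mulr_ge0// ltW.
  by move=> i ij; rewrite normrM (le_trans _ (wi _ ij))// ler_piMl.
move=> i; have [->//|ij] := eqVneq i j.
by rewrite (le_trans (wi _ ij))// ler_wpM2r ?(ltW t0)// expr2 ler_peMl//
  (le_trans ler01).
Qed.

Lemma truncn_eq_dist (R : archiRealFieldType) (x y : R) :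
  0 <= x -> 0 <= y -> Num.truncn x = Num.truncn y -> `|x - y| < 1.
Proof.
move=> /truncn_itv xt /truncn_itv yt e; move: xt yt; rewrite e -natr1.
by move=> /andP[? ?] /andP[? ?]; rewrite ltr_norml; lra.
Qed.

(* Grid cells are recorded in the [d - 2] coordinates other than [j] and the
   coordinate [k a] in which the tangential part of [x a - c] is largest;
   by [chord_bound] these control the two missing coordinates. *)
Lemma sphere_hyperplane_packing (R : archiRealFieldType) (d : nat) (J : finType)
    (x : J -> 'I_d -> R) (n c : 'I_d -> R) (h rho l b : R) (M : nat) :
  (2 <= d)%N -> (exists i, n i != 0) ->
  (forall a, \sum_i n i * x a i = h) ->
  (forall a, \sum_i (x a i - c i) ^+ 2 = rho) ->
  (forall a i, `|x a i| <= b) ->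
  0 < l ->
  (forall a a', a != a' -> exists i, l <= `|x a i - x a' i|) ->
  4 * d%:R ^+ 2 * b / l < M.+1%:R ->
  (#|J| <= d * 2 * M.+1 ^ (d - 2))%N.
Proof.
move=> d2 [i0 ni0] nx cx xb l0 sep bM.
pose j := [arg max_(i > i0) `|n i|]%O.
have nmax i : `|n i| <= `|n j| by rewrite /j; case: arg_maxP => // m _; exact.
have nj0 : n j != 0 by rewrite -normr_gt0 (lt_le_trans _ (nmax i0))// normr_gt0.
have [k0 k0j] : exists k, k != j.
  have : (0 < #|[set~ j]|)%N by rewrite cardsC1 card_ord; lia.
  by move=> /card_gt0P[k]; rewrite !inE => kj; exists k.
pose G := tangent_coord n j.
pose u a i := x a i - c i.
pose k a := [arg max_(i > k0 | i != j) `|G (u a) i|]%O.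
have kP a : k a != j /\ forall i, i != j -> `|G (u a) i| <= `|G (u a) (k a)|.
  by rewrite /k; case: arg_maxP => // m mj mmax; split => //.
(* With this mesh the bound of [chord_bound] equals [l / 2], which contradicts the separation. *)
pose t := l / (2 * d%:R ^+ 2).
have d0 : 0 < d%:R :> R by rewrite ltr0n; lia.
have t0 : 0 < t by rewrite divr_gt0// mulr_gt0// exprn_gt0.
have xb0 a i : 0 <= (x a i + b) / t.
  by rewrite divr_ge0 ?(ltW t0)//; have := xb a i; rewrite ler_norml; lra.
have xM a i : (Num.truncn ((x a i + b) / t) < M.+1)%N.
  rewrite truncn_lt_nat//; apply: le_lt_trans bM.
  rewrite /t invf_div mulrA ler_wpM2r ?invr_ge0 ?(ltW l0)//.
  have -> : 4 * d%:R ^+ 2 * b = (2 * b) * (2 * d%:R ^+ 2) by ring.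
  rewrite ler_wpM2r ?mulr_ge0 ?exprn_ge0 ?(ltW d0)//.
  by have := xb a i; rewrite ler_norml; lra.
(* The factor [d * 2] counts the pairs of a dominant coordinate and a sign, which [chord_bound]
   wants common to both points; on a class of [g] the map [cell] is injective. *)
pose g a : 'I_d * bool := (k a, 0 <= G (u a) (k a)).
pose cell a := [ffun i => if (i == j) || (i == k a) then ord0 else Ordinal
  (xM a i)].
have -> : (d * 2 = #|{: 'I_d * bool}|)%N by rewrite card_prod card_ord
  card_bool.
rewrite -cardsT; apply: (card_le_fibers (f := g)) => -[k1 s1].
rewrite -(@card_in_imset _ _ cell); last first.
  move=> a a'; rewrite !inE /g /= => /eqP[ka sa] /eqP[ka' sa'] /ffunP e.
  apply/eqP; apply: contraT => aa'; have [i] := sep _ _ aa'.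
  have xu m : u a m - u a' m = x a m - x a' m by rewrite /u; ring.
  have [kaj Ga] := kP a; have [ka'j Ga'] := kP a'.
  suff e' : `|u a i - u a' i| <= d%:R ^+ 2 * t.
    rewrite -xu => le; have := le_trans le e'.
    have -> : d%:R ^+ 2 * t = l / 2 by rewrite /t; field; rewrite gt_eqF.
    lra.
  rewrite ka in kaj Ga sa; rewrite ka' in ka'j Ga' sa'.
  apply: (chord_bound nj0 nmax kaj) => //.
  - rewrite (eq_bigr (fun i => n i * x a i - n i * x a' i)); last first.
      by move=> m _; rewrite xu mulrBr.
    by rewrite sumrB !nx subrr.
  - by rewrite !cx.
  - by rewrite -/G sa sa'.
  - move=> m mj mk; rewrite xu; move: (e m);
    rewrite !ffunE ka ka' (negPf mj) (negPf mk)/=.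
    move=> /(congr1 (@nat_of_ord _))/= /truncn_eq_dist =>
      /(_ (xb0 _ _) (xb0 _ _)).
    rewrite -mulrBl opprD addrACA subrr addr0 normrM [X in _ * X]gtr0_norm
      ?invr_gt0//.
    by rewrite ltr_pdivrMr// mul1r; exact: ltW.
have [->|kj] := eqVneq k1 j.
  rewrite (_ : [set _ in _ | _] = finset.set0) ?imset0 ?cards0//.
  apply/setP => a; rewrite !inE /=; apply/negbTE/eqP => -[ka _].
  by have [] := kP a; rewrite ka eqxx.
have <- : #|~: [set j; k1]| = (d - 2)%N.
  by rewrite cardsCs finset.setCK cards2 card_ord eq_sym kj.
apply: card_ffun_vanishing => f i /imsetP[a]; rewrite !inE => /eqP[ka _] -> {f}.
by rewrite negbK ffunE ka => ->.
Qed.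

(** * Discrete Frostman measures *)

(** Greedy induction on [s]: the new point receives the least slack among its classes at levels up
    to [n]. The caps still hold, a class attaining the minimum becomes saturated, and saturated
    classes stay so because weights only grow. *)
Lemma saturated_weights_seq (R : realFieldType) (T : finType) (K : eqType)
    (n : nat) (lab : nat -> T -> K) (cap : nat -> R) (s : seq T) :
  (forall m, 0 <= cap m) ->
  exists w : T -> R, [/\ forall t, 0 <= w t,
    forall t, t \notin s -> w t = 0,
    forall m k, (m <= n)%N -> \sum_(u | lab m u == k) w u <= cap m &
    forall t, t \in s ->
      exists2 m, (m <= n)%N & \sum_(u | lab m u == lab m t) w u = cap m].
Proof.
move=> cap0; elim: s => [|t s [w [w0 ws wcap wt]]].
  by exists (fun=> 0); split=> // m k _; rewrite big1.
pose f (m : 'I_n.+1) := cap m - \sum_(u | lab m u == lab m t) w u.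
pose m0 := [arg min_(m < ord0) f m]%O.
have fmin m : f m0 <= f m by rewrite /m0; case: arg_minP => // i _; exact.
have f0 m : 0 <= f m by rewrite subr_ge0 wcap// -ltnS.
pose w' u := w u + (u == t)%:R * f m0.
have sumw' m k : \sum_(u | lab m u == k) w' u =
    \sum_(u | lab m u == k) w u + (lab m t == k)%:R * f m0.
  rewrite big_split/=; congr +%R; rewrite big_mkcond (bigD1 t)//= eqxx mul1r.
  rewrite big1 ?addr0; first by case: ifP; rewrite ?mul1r ?mul0r.
  by move=> u /negPf ->; rewrite mul0r if_same.
have w'0 u : 0 <= w' u by rewrite addr_ge0 ?mulr_ge0.
have w'cap m k : (m <= n)%N -> \sum_(u | lab m u == k) w' u <= cap m.
  move=> mn; rewrite sumw'; have [<-|_] := eqVneq (lab m t) k; last first.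
    by rewrite mul0r addr0 wcap.
  have mn' : (m < n.+1)%N by [].
  by rewrite mul1r -lerBrDl (fmin (Ordinal mn')).
exists w'; split => //.
  move=> u; rewrite inE negb_or => /andP[/negPf ut us].
  by rewrite /w' ut mul0r addr0 ws.
move=> u; rewrite inE => /orP[/eqP ->|us].
  exists (nat_of_ord m0); first by rewrite -ltnS.
  by rewrite sumw' eqxx mul1r /f addrC subrK.
have [m mn tight] := wt _ us; exists m => //.
apply/eqP; rewrite eq_le w'cap//= -tight sumw' lerDl mulr_ge0//.
Qed.

(* A discrete Frostman lemma.  Each point is given in turn the largest weight
   allowed, so that each point ends up in a saturated class; the coarsest
   saturated classes form the disjoint cover [A]. *)
Lemma discrete_frostman (R : realFieldType) (T : finType) (K : eqType)
    (n : nat) (lab : nat -> T -> K) (cap : nat -> R) (P : pred T) :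
  (forall m, 0 <= cap m) ->
  (forall m m' t u, (m' <= m <= n)%N -> lab m t = lab m u ->
    lab m' t = lab m' u) ->
  exists w : T -> R, exists A : {set T}, exists lev : T -> nat,
  [/\ forall t, 0 <= w t, forall t, ~~ P t -> w t = 0 &
      forall m k, (m <= n)%N -> \sum_(u | lab m u == k) w u <= cap m] /\
  [/\ forall a, a \in A -> P a /\ (lev a <= n)%N,
      forall t, P t -> exists2 a, a \in A & lab (lev a) t = lab (lev a) a &
      \sum_(a in A) cap (lev a) <= \sum_t w t].
Proof.
move=> cap0 nest.
have [w [w0 wP wcap wt]] := saturated_weights_seq n lab (enum P) cap0.
pose tight (m : nat) t := \sum_(u | lab m u == lab m t) w u == cap m.
(* The coarsest saturated level, as [find] scans the levels upwards from 0. *)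
pose lev t := find (tight^~ t) (iota 0 n.+1).
have levn t : P t -> (lev t <= n)%N /\ tight (lev t) t.
  move=> Pt; have /wt[m mn e] : t \in enum P by rewrite mem_enum.
  have ht : has (tight^~ t) (iota 0 n.+1).
    by apply/hasP; exists m; [rewrite mem_iota|apply/eqP].
  have lt : (lev t < n.+1)%N by rewrite /lev -{2}(size_iota 0 n.+1) -has_find.
  by split=> //; have := nth_find 0 ht; rewrite nth_iota.
have levmin t m : (m <= n)%N -> tight m t -> (lev t <= m)%N.
  move=> mn tm; rewrite leqNgt; apply/negP => ml.
  by have := before_find 0 ml; rewrite nth_iota// add0n tm.
(* Points with the same coarsest saturated class are identified; [rep] picks one of them, so that
   each class enters [A] once. *)
pose E t u := [&& P u, lev u == lev t & lab (lev t) u == lab (lev t) t].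
pose rep t := odflt t [pick u | E t u].
have repP t : P t -> E t (rep t).
  by move=> Pt; rewrite /rep; case: pickP => // /(_ t); rewrite /E Pt !eqxx.
have repE t u : P t -> E t u -> rep u = rep t.
  move=> Pt /and3P[Pu /eqP luv /eqP lab_e]; rewrite /rep.
  rewrite (@eq_pick _ (E u) (E t)); last by move=> v; rewrite /E luv lab_e.
  by case: pickP => // /(_ t); rewrite /E Pt !eqxx.
exists w, [set rep t | t in P], lev; split.
  by split => // t Pt; apply: wP; rewrite mem_enum.
have AP a : a \in [set rep t | t in P] ->
  [/\ P a, (lev a <= n)%N, tight (lev a) a & rep a = a].
  move=> /imsetP[t Pt ->]; have Et := repP _ Pt.
  have /and3P[Pa _ _] := Et; have [? ?] := levn _ Pa.
  by split => //; apply: repE.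
split.
- by move=> a /AP[].
- move=> t Pt; exists (rep t); first exact: imset_f.
  by have /and3P[_ /eqP-> /eqP->] := repP _ Pt.
have sumE a : a \in [set rep t | t in P] ->
    cap (lev a) = \sum_u (lab (lev a) u == lab (lev a) a)%:R * w u.
  move=> /AP[_ _ /eqP <- _]; rewrite big_mkcond/=; apply: eq_bigr => u _.
  by case: eqP; rewrite ?mul1r ?mul0r.
(* It remains to see that [u] lies in at most one chosen class. Of two classes containing [u], the
   coarser contains the other, and minimality of [lev] then makes them equal. *)
rewrite (eq_bigr _ sumE) exchange_big/=; apply: ler_sum => u _.
rewrite -mulr_suml ler_piMl// -natr_sum lern1.
rewrite leqNgt; apply/negP => c1.
have : (1 < #|[set a in [set rep t | t in P] | lab (lev a) u == lab (lev a)
  a]|)%N.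
  rewrite (leq_trans c1)// -sum1_card big_mkcond/= [leqRHS]big_mkcond/=.
  by apply: leq_sum => a _; rewrite inE; case: ifP => //=; case: eqP.
move=> /card_gt1P[a [a' []]]; rewrite !inE => /andP[/AP[Pa la ta ra] /eqP ua].
move=> /andP[/AP[Pa' la' ta' ra'] /eqP ua'].
wlog lea : a a' Pa la ta ra ua Pa' la' ta' ra' ua' / (lev a <= lev a')%N.
  move=> W; have [le|/ltnW le] := leqP (lev a) (lev a'); first exact: W.
  by rewrite eq_sym; apply: W.
have labaa' : lab (lev a) a' = lab (lev a) a.
  by rewrite -ua; apply: (nest (lev a')) => //; rewrite lea.
have : (lev a' <= lev a)%N.
  by apply: levmin => //; rewrite /tight labaa'.
move=> lea'; have lee : lev a = lev a' by apply/eqP; rewrite eqn_leq lea.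
suff -> : a = a' by rewrite eqxx.
by rewrite -ra -ra'; apply/esym/repE => //;
  rewrite /E Pa' lee eqxx -lee labaa' eqxx.
Qed.

(** * Transversality of the heights *)

Section Transversality.
Variables (R : rcfType) (d : nat) (i0 : 'I_d) (r l0 : R).
Hypotheses (r0 : 0 < r) (l00 : 0 <= l0) (l0r : 8 * d%:R * l0 <= r).
Implicit Types x y z : 'I_d -> R.

(** [x i0 + cap_height x z] is the [i0] coordinate of the centre, above [x], of a sphere of radius
    [r] through [x], the other coordinates of the centre being those of [z]. *)
Definition cap_height (x z : 'I_d -> R) : R :=
  Num.sqrt (r ^+ 2 - \sum_(j | j != i0) (x j - z j) ^+ 2).

Definition box_close x z := forall j, `|x j - z j| <= l0.

Let d1 : 1 <= d%:R :> R. Proof. by rewrite ler1n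
  (leq_ltn_trans _ (ltn_ord i0)). Qed.

Let l0r8 : 8 * l0 <= r.
Proof. by apply: le_trans l0r; rewrite -mulrA ler_wpM2l// ler_peMl. Qed.

(** The smallness of [l0] keeps the sum of squares at most [r ^ 2 / 2], so the radicand is positive
    and the height comparable to [r]. *)
Lemma cap_heightE x z : box_close x z -> [/\ r / 2 <= cap_height x z,
  cap_height x z <= r &
  cap_height x z ^+ 2 = r ^+ 2 - \sum_(j | j != i0) (x j - z j) ^+ 2].
Proof.
move=> xz; rewrite /cap_height; set s := \sum_(j | _) _.
have s0 : 0 <= s by apply: sumr_ge0 => j _; exact: sqr_ge0.
have sr : s <= r ^+ 2 / 2.
  apply: (@le_trans _ _ (d%:R * l0 ^+ 2)).
    apply: sum_le_card; first exact: sqr_ge0.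
    by move=> j _; rewrite -real_normK ?num_real// ler_sqr ?nnegrE.
  have : d%:R * l0 ^+ 2 <= (d%:R * l0) ^+ 2.
    by rewrite exprMn ler_wpM2r ?sqr_ge0// expr2 ler_peMl// (le_trans ler01).
  have : (8 * d%:R * l0) ^+ 2 <= r ^+ 2.
    by rewrite ler_sqr ?nnegrE ?(ltW r0)// !mulr_ge0.
  have := sqr_ge0 r.
  rewrite !exprMn; lra.
have p0 : 0 <= r ^+ 2 - s by have := sqr_ge0 r; lra.
split; last by rewrite sqr_sqrtr.
- rewrite -(@ler_sqr R) ?nnegrE ?sqrtr_ge0 ?divr_ge0 ?(ltW r0)// sqr_sqrtr//.
  by have := sqr_ge0 r; rewrite expr_div_n; lra.
- by rewrite -(@ler_sqr R) ?nnegrE ?sqrtr_ge0 ?(ltW r0)// sqr_sqrtr// gerBl.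
Qed.

(** The squares differ by at most [d * D * 2 * l0 <= D * r / 4], and the two heights add up to at
    least [r]. The same factorisation of a difference of squares gives [cap_height_move]. *)
Lemma cap_height_diff x y z (D : R) : box_close x z -> box_close y z ->
  (forall j, j != i0 -> `|x j - y j| <= D) ->
  0 <= D -> `|cap_height x z - cap_height y z| <= D / 4.
Proof.
move=> xz yz xyD D0.
have [Ax xA A2] := cap_heightE xz; have [By yB B2] := cap_heightE yz.
set A := cap_height x z in Ax xA A2 *; set B := cap_height y z in By yB B2 *.
have q : `|A ^+ 2 - B ^+ 2| <= D * r / 4.
  have -> : A ^+ 2 - B ^+ 2 =
      \sum_(j | j != i0) (y j - x j) * ((x j - z j) + (y j - z j)).
    rewrite A2 B2 opprD addrACA subrr add0r opprK addrC -sumrB.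
    by apply: eq_bigr => j _; ring.
  rewrite (le_trans (ler_norm_sum _ _ _))//.
  apply: (@le_trans _ _ (d%:R * (D * (2 * l0)))).
    apply: sum_le_card; first by rewrite !mulr_ge0.
    move=> j ji; rewrite normrM ler_pM//; first by rewrite distrC xyD.
    by rewrite (le_trans (ler_normD _ _))//; have := xz j; have := yz j; lra.
  have := ler_wpM2l D0 l0r; lra.
rewrite -(ler_pM2r r0); apply: le_trans (_ : D * r / 4 <= _); last by lra.
apply: le_trans q; rewrite subr_sqr normrM ler_wpM2l//.
by rewrite ger0_norm; lra.
Qed.

Lemma cap_height_move x z z' i : box_close x z -> box_close x z' -> i != i0 ->
  (forall j, j != i -> z j = z' j) ->
  `|cap_height x z - cap_height x z'| <= `|z i - z' i| / 4.
Proof.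
move=> xz xz' ii zz'.
have [Ax xA A2] := cap_heightE xz; have [By yB B2] := cap_heightE xz'.
set A := cap_height x z in Ax xA A2 *; set B := cap_height x z' in By yB B2 *.
have q : A ^+ 2 - B ^+ 2 = (z i - z' i) * ((x i - z i) + (x i - z' i)).
  rewrite A2 B2 (bigD1 i)//= [in X in _ - X](bigD1 i)//=.
  rewrite (eq_bigr (fun j => (x j - z' j) ^+ 2)); first by ring.
  by move=> j /andP[_ /zz' ->].
have q' : `|A ^+ 2 - B ^+ 2| <= `|z i - z' i| * (r / 4).
  rewrite q normrM ler_wpM2l// (le_trans (ler_normD _ _))//.
  have := xz i; have := xz' i; have := l0r8; lra.
rewrite -(ler_pM2r r0).
apply: le_trans (_ : `|z i - z' i| * (r / 4) <= _); last by lra.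
apply: le_trans q'; rewrite subr_sqr normrM ler_wpM2l//.
by rewrite ger0_norm; lra.
Qed.

(** When [z] moves along the axis [i], the change of [A ^ 2 - B ^ 2] is exactly
    [2 * (x i - y i) * (z' i - z i)]. In terms of the heights it is at most [4 * r * t + D * e / 8],
    and the last term, due to the two preceding lemmas, is absorbed on the left. *)
Lemma cap_height_transversal x y z z' i (t : R) :
  box_close x z -> box_close y z -> box_close x z' -> box_close y z' ->
    i != i0 ->
  (forall j, j != i -> z j = z' j) ->
  (forall j, j != i0 -> `|x j - y j| <= `|x i - y i|) ->
  `|(x i0 + cap_height x z) - (y i0 + cap_height y z)| <= t ->
  `|(x i0 + cap_height x z') - (y i0 + cap_height y z')| <= t ->
  `|x i - y i| * `|z i - z' i| <= 4 * r * t.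
Proof.
move=> xz yz xz' yz' ii zz' xyi xyt xyt'.
have [Ax xA A2] := cap_heightE xz; have [By yB B2] := cap_heightE yz.
have [Ax' xA' A2'] := cap_heightE xz'; have [By' yB' B2'] := cap_heightE yz'.
have dAB := cap_height_diff xz yz xyi (normr_ge0 _).
have dA := cap_height_move xz xz' ii zz'.
have dB := cap_height_move yz yz' ii zz'.
set A := cap_height x z in Ax xA A2 dA dAB xyt *.
set B := cap_height y z in By yB B2 dB dAB xyt *.
set A' := cap_height x z' in Ax' xA' A2' dA xyt' *.
set B' := cap_height y z' in By' yB' B2' dB xyt' *.
set D := `|x i - y i| in xyi dAB *; set e := `|z i - z' i| in dA dB *.
have D0 : 0 <= D by exact: normr_ge0.
have e0 : 0 <= e by exact: normr_ge0.
have t0 : 0 <= t by apply: le_trans xyt; exact: normr_ge0.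
have mv u : \sum_(j | j != i0) (u j - z' j) ^+ 2 =
    \sum_(j | j != i0) (u j - z j) ^+ 2 + (u i - z' i) ^+ 2 - (u i - z i) ^+ 2.
  rewrite (bigD1 i)//= [in RHS](bigD1 i)//=
    [X in _ + X](eq_bigr (fun j => (u j - z j) ^+ 2)); first by ring.
  by move=> j /andP[_ /zz' ->].
have q : (A' ^+ 2 - B' ^+ 2) - (A ^+ 2 - B ^+ 2) = 2 *
  ((x i - y i) * (z' i - z i)).
  by rewrite A2 B2 A2' B2' !mv; ring.
have qn : `|(A' ^+ 2 - B' ^+ 2) - (A ^+ 2 - B ^+ 2)| = 2 * (D * e).
  by rewrite q !normrM [`|2|]ger0_norm// [`|z' i - _|]distrC.
have q2 : (A' ^+ 2 - B' ^+ 2) - (A ^+ 2 - B ^+ 2) =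
   ((A' - B') - (A - B)) * (A' + B') + (A - B) * ((A' - A) + (B' - B)) by ring.
have h1 : `|(A' - B') - (A - B)| <= 2 * t.
  have -> : (A' - B') - (A - B) = ((x i0 + A') - (y i0 + B')) -
    ((x i0 + A) - (y i0 + B)) by ring.
  by rewrite (le_trans (ler_normB _ _))//; lra.
have h2 : `|(A' - A) + (B' - B)| <= e / 2.
  rewrite (le_trans (ler_normD _ _))// distrC [`|B' - B|]distrC; lra.
have : 2 * (D * e) <= 2 * t * (2 * r) + D / 4 * (e / 2).
  rewrite -qn q2 (le_trans (ler_normD _ _))// !normrM lerD// ler_pM//.
  by rewrite ger0_norm; lra.
have : 0 <= D * e by rewrite mulr_ge0.
have : 0 <= t * r by rewrite mulr_ge0// ltW.
lra.
Qed.

End Transversality.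

(** * Counting pairs in a common bucket *)

(** Cauchy-Schwarz over the classes of [c]: the double sum is the sum of the squared masses of the
    classes. *)
Lemma sqr_sum_le_fibers (R : realFieldType) (T K : finType) (w : T ->
  R) (c : T -> K)
    (A : {set K}) :
  (forall t, 0 <= w t) -> (forall t, w t != 0 -> c t \in A) ->
  (\sum_t w t) ^+ 2 <= #|A|%:R * \sum_t \sum_(u | c u == c t) w t * w u.
Proof.
move=> w0 cA; pose W k := \sum_(t | c t == k) w t.
have W0 k : k \notin A -> W k = 0.
  move=> kA; apply: big1 => t /eqP ctk; apply/eqP; apply: contraNT kA => /cA.
  by rewrite ctk.
have -> : \sum_t w t = \sum_(k in A) W k.
  rewrite (partition_big c predT)//= [RHS]big_mkcond/=; apply: eq_bigr => k _.
  by case: ifPn => // /W0.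
have -> : \sum_t \sum_(u | c u == c t) w t * w u = \sum_(k in A) W k ^+ 2.
  rewrite (partition_big c predT)//= [RHS]big_mkcond/=; apply: eq_bigr => k _.
  transitivity (W k ^+ 2); last by case: ifPn => // /W0 ->; rewrite expr0n.
  rewrite expr2 [in RHS]/W mulr_suml; apply: eq_bigr => t /eqP ->.
  by rewrite mulr_sumr.
have -> : (\sum_(k in A) W k) ^+ 2 = \sum_(k in A) \sum_(l in A) W k * W l.
  by rewrite expr2 mulr_suml; apply: eq_bigr => k _; rewrite mulr_sumr.
apply: (@le_trans _ _ (\sum_(k in A) \sum_(l in A) (W k ^+ 2 + W l ^+ 2) / 2)).
  apply: ler_sum => k _; apply: ler_sum => l _.
  by have := sqr_ge0 (W k - W l); rewrite sqrrB -mulr_natl; lra.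
have S1 : \sum_(k in A) \sum_(l in A) W k ^+ 2 = #|A|%:R * \sum_(k in A) W k ^+
  2.
  by rewrite mulr_sumr; apply: eq_bigr => k _; rewrite sumr_const mulr_natl.
have S2 : \sum_(k in A) \sum_(l in A) W l ^+ 2 = #|A|%:R * \sum_(k in A) W k ^+
  2.
  by rewrite exchange_big.
rewrite (eq_bigr (fun k => (\sum_(l in A) W k ^+ 2 + \sum_(l in A) W l ^+ 2) /
  2)).
  by rewrite -mulr_suml big_split/= S1 S2; lra.
by move=> k _; rewrite -big_split mulr_suml.
Qed.

Lemma geometric_tail_le (R : realFieldType) (x : R) (k n : nat) :
  0 <= x < 1 -> \sum_(k <= m < n) x ^+ m <= x ^+ k / (1 - x).
Proof.
move=> /andP[x0 x1]; rewrite ler_pdivlMr ?subr_gt0//.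
elim: n => [|n IH].
  by rewrite big_geq// mul0r exprn_ge0.
have [kn|nk] := leqP k n; last by rewrite big_geq// mul0r exprn_ge0.
suff -> : (\sum_(k <= m < n.+1) x ^+ m) * (1 - x) = x ^+ k - x ^+ n.+1.
  by rewrite gerBl exprn_ge0.
rewrite big_nat_recr//= exprS.
elim: n kn {IH} => [|n IH].
  by rewrite leqn0 => /eqP ->; rewrite big_geq//; ring.
rewrite leq_eqVlt => /orP[/eqP <-|kn]; first by rewrite big_geq//; ring.
by rewrite big_nat_recr//= mulrDl IH// !exprS; ring.
Qed.

(** The points [p t] with [Q t] lie in one cube of side [l0] with corner [base]; [lab m] names the
    cube of side [len m] containing a point, and [w] gives such a cube mass at most [q ^ m]. *)
Section BucketCount.
Variables (R : archiRcfType) (d : nat) (i0 : 'I_d) (r l0 b : R).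
Variables (K n k : nat) (T : finType) (Q : pred T) (w : T -> R).
Variables (p : T -> 'I_d -> R) (lab : nat -> T -> {ffun 'I_d -> 'I_K}).
Variables (base : 'I_d -> R) (q : R).
Let len (m : nat) : R := l0 / 2 ^+ m.
Hypotheses (r0 : 0 < r) (l00 : 0 < l0) (l0r : 8 * d%:R * l0 <= r).
Hypothesis kn : (k <= n)%N.
Hypothesis labP : forall t m i, Q t -> (m <= n)%N ->
  len m * (lab m t i)%:R <= p t i + b < len m * (lab m t i).+1%:R.
Hypothesis pbase : forall t i, Q t -> base i <= p t i <= base i + l0.
Hypothesis w0 : forall t, 0 <= w t.
Hypothesis wQ : forall t, ~~ Q t -> w t = 0.
Hypothesis q0 : 0 < q.
Hypothesis q1 : 2 * q < 1.
Hypothesis wcap : forall m c, (m <= n)%N ->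
  \sum_(u | lab m u == c) w u <= q ^+ m.
Hypothesis pb : forall t i, Q t -> `|p t i| <= b.

(** Heights are cut into intervals of length [len n]; the shift by [b] makes the quotient
    nonnegative for the points in question, so that [truncn] is the floor. *)
Definition bucket (z : 'I_d -> R) (t : T) : nat :=
  Num.truncn ((p t i0 + cap_height i0 r (p t) z + b) / len n).

Let len_gt0 m : 0 < len m. Proof. by rewrite /len divr_gt0// exprn_gt0//. Qed.

Let lenS m : len m = 2 * len m.+1.
Proof. by rewrite /len exprS invfM; field; rewrite expf_neq0 ?pnatr_eq0. Qed.

Let nbr (m : nat) (t u : T) : bool :=
  [forall i, (lab m t i <= (lab m u i).+1)%N &&
    (lab m u i <= (lab m t i).+1)%N].

(** A cube has at most [3 ^ d] neighbours, itself included, since each coordinate of the label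
    changes by at most 1. *)
Lemma nbr_mass m u : (m <= n)%N -> \sum_(t | nbr m t u) w t <= 3 ^+ d * q ^+ m.
Proof.
move=> mn; pose D := [set lab m t | t in nbr m ^~ u].
have D3 : (#|D| <= 3 ^ d)%N.
  pose f (c : {ffun 'I_d -> 'I_K}) : {ffun 'I_d -> 'I_3} :=
    [ffun i => inord (c i + 1 - lab m u i)].
  rewrite -(@card_in_imset _ _ f).
    by rewrite (leq_trans (max_card _))// card_ffun !card_ord.
  move=> c c' /imsetP[t /forallP tu ->] /imsetP[t' /forallP t'u ->] /ffunP e.
  apply/ffunP => i; move: (e i); rewrite !ffunE => /(congr1 (@nat_of_ord _)).
  have /andP[? ?] := tu i; have /andP[? ?] := t'u i.
  by rewrite !inordK; [move=> ?; apply/val_inj => /=; lia|lia..].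
rewrite (partition_big (lab m) (mem D))/=; last by move=> t tu; exact: imset_f.
apply: (@le_trans _ _ (\sum_(c in D) q ^+ m)).
  apply: ler_sum => c _; apply: le_trans (wcap c mn).
  rewrite big_mkcond [leRHS]big_mkcond/=; apply: ler_sum => t _.
  by case: (nbr m t u) => //=; case: ifP.
rewrite sumr_const -[leLHS]mulr_natl ler_wpM2r ?exprn_ge0 ?(ltW q0)//.
by rewrite -natrX ler_nat.
Qed.

Let N := (2 ^ n)%N.
Definition grid (tau : {ffun 'I_d -> 'I_N}) (i : 'I_d) : R :=
  base i + len n * (tau i)%:R.

Lemma grid_close tau t : Q t -> box_close l0 (p t) (grid tau).
Proof.
move=> Qt i; rewrite /grid ler_norml.
have : len n * (tau i)%:R <= l0.
  rewrite /len -mulrA ler_piMr ?(ltW l00)// ler_pdivrMl ?exprn_gt0// mulr1.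
  by rewrite -natrX ler_nat ltnW// ltn_ord.
have : 0 <= len n * (tau i)%:R by rewrite mulr_ge0 ?(ltW (len_gt0 _)).
by have := pbase i Qt; lra.
Qed.

(** For points at distance at least [len m.+1] and tolerance [len n], transversality bounds the move
    of [z] by [4 * r * len n / len m.+1], that is, by [8 * r / l0 * 2 ^ m] grid steps. *)
Let C1 := (Num.truncn (8 * r / l0)).+1.

Lemma bucket_dist z t u : Q t -> Q u -> box_close l0 (p t) z ->
  box_close l0 (p u) z ->
  bucket z t = bucket z u ->
  `|(p t i0 + cap_height i0 r (p t) z) - (p u i0 + cap_height i0 r (p u) z)| <=
    len n.
Proof.
move=> Qt Qu tz uz; rewrite /bucket => /truncn_eq_dist e.
have ge0 v : Q v -> box_close l0 (p v) z ->
  0 <= (p v i0 + cap_height i0 r (p v) z + b) / len n.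
  move=> Qv vz; rewrite divr_ge0 ?(ltW (len_gt0 _))//.
  have [h _ _] := cap_heightE i0 r0 (ltW l00) l0r vz.
  by have := pb i0 Qv; rewrite ler_norml; have := r0; lra.
have := e (ge0 _ Qt tz) (ge0 _ Qu uz).
rewrite -mulrBl opprD addrACA subrr addr0 normrM [X in _ * X]gtr0_norm
  ?invr_gt0//.
by rewrite ltr_pdivrMr// mul1r => /ltW.
Qed.

(** If [n <= m.+1], the number of all grid points is small enough. Otherwise the points differ by at
    least [len m.+1] in some coordinate; let [D] be one of largest difference. If [D] were [i0], the
    centre heights would differ by three quarters of that, more than [len n]. So transversality
    confines [tau D] to a window once the other coordinates are fixed, and [card_ffun_gap]
    applies. *)
Lemma common_bucket_count_level t u m : Q t -> Q u -> (m <= n)%N ->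
  (m = n \/ (m < n)%N /\ ~~ nbr m.+1 t u) ->
  (#|[set tau | bucket (grid tau) t == bucket (grid tau) u]| <=
     C1.+1 * 2 ^ m * N ^ d.-1)%N.
Proof.
move=> Qt Qu mn mmax.
have d_gt0 : (0 < d)%N by rewrite (leq_ltn_trans _ (ltn_ord i0)).
have [nm|mn1] := leqP n m.+1.
  rewrite (leq_trans (max_card _))// card_ffun !card_ord.
  rewrite -[X in (N ^ X <= _)%N](prednK d_gt0) expnS leq_mul2r; apply/orP;
    right.
  rewrite /N (@leq_trans (2 ^ m.+1))//; first by rewrite leq_exp2l.
  by rewrite expnS leq_mul2r ltnS orbT.
have {mmax} far : ~~ nbr m.+1 t u by case: mmax => [|[]//]; lia.
set S := [set _ | _].
have [D [lenD tuD]] : exists i, len m.+1 <= `|p t i - p u i| /\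
    forall j, `|p t j - p u j| <= `|p t i - p u i|.
  have /forallPn[j] := far; rewrite negb_and -!ltnNge => farj.
  pose i := [arg max_(i > i0) `|p t i - p u i|]%O.
  have imax j' : `|p t j' - p u j'| <= `|p t i - p u i|.
    by rewrite /i; case: arg_maxP => // x _; exact.
  exists i; split=> //; apply: le_trans (imax j).
  have /andP[t1 t2] := labP j Qt (ltnW mn1);
    have /andP[u1 u2] := labP j Qu (ltnW mn1).
  have lg := len_gt0 m.+1.
  have S1 v : v.+1%:R = v%:R + 1 :> R by rewrite natr1.
  have S2 v : v.+2%:R = v%:R + 2 :> R by rewrite -natrD addn2.
  case/orP: farj => farj.
    have : (lab m.+1 u j).+2%:R <= (lab m.+1 t j)%:R :> R by rewrite ler_nat.
    rewrite S2 => /(ler_wpM2l (ltW lg)); rewrite mulrDr.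
    move: u2; rewrite S1 mulrDr => u2 h.
    by rewrite ger0_norm; lra.
  have : (lab m.+1 t j).+2%:R <= (lab m.+1 u j)%:R :> R by rewrite ler_nat.
  rewrite S2 => /(ler_wpM2l (ltW lg)); rewrite mulrDr.
  move: t2; rewrite S1 mulrDr => t2 h.
  by rewrite ler0_norm; lra.
have [->|[tau0]] := set_0Vmem S; first by rewrite cards0.
rewrite inE => /eqP tau0S.
have lenm2 : 2 * len n <= len m.+1.
  rewrite [leRHS]lenS ler_wpM2l// /len ler_wpM2l ?(ltW l00)// lef_pV2 ?posrE
    ?exprn_gt0//.
  by rewrite ler_weXn2l// ler1n.
have Di0 : D != i0.
  apply/eqP => Di0.
  have tz := grid_close tau0 Qt; have uz := grid_close tau0 Qu.
  have := bucket_dist Qt Qu tz uz tau0S.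
  have := @cap_height_diff R d i0 r l0 r0 (ltW l00) l0r _ _ _ _ tz uz
    (fun j _ => tuD j) (normr_ge0 _).
  rewrite opprD addrACA -Di0 => h1 h2.
  have := lerB_normD (p t D - p u D)
    (cap_height i0 r (p t) (grid tau0) - cap_height i0 r (p u) (grid tau0)).
  have := len_gt0 n; rewrite Di0 in lenD h1 h2 *; lra.
apply: (@leq_trans ((C1 * 2 ^ m).+1 * N ^ d.-1)).
  rewrite -[X in (_ <= _ * _ ^ X.-1)%N]card_ord;
    apply: (@card_ffun_gap _ _ _ D).
  move=> f g; rewrite !inE => /eqP fS /eqP gS fg.
  have := @cap_height_transversal R d i0 r l0 r0 (ltW l00) l0r (p t) (p u)
    (grid f) (grid g) D (len n)
    (grid_close f Qt) (grid_close f Qu) (grid_close g Qt) (grid_close g Qu) Di0.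
  have dist tau : bucket (grid tau) t = bucket (grid tau) u -> _ :=
    bucket_dist Qt Qu (grid_close tau Qt) (grid_close tau Qu).
  move=> /(_ _ _ (dist _ fS) (dist _ gS)) h.
  have {h} := h (fun j jD => congr1 (fun v : 'I_N => base j + len n * v%:R)
    (fg j jD)) (fun j _ => tuD j).
  rewrite /grid opprD addrACA subrr add0r -mulrBr normrM [`|len n|]gtr0_norm//
    => h.
  rewrite -(ler_nat R) natrD natrM natrX -lerBlDl.
  apply: (@le_trans _ _ (8 * r / l0 * 2 ^+ m)); last first.
    by rewrite ler_wpM2r ?exprn_ge0//; exact/ltW/truncnS_gt.
  apply: le_trans (ler_norm _) _; rewrite -(ler_pM2l (len_gt0 n)).
  rewrite -(ler_pM2l (len_gt0 m.+1)).
  apply: (@le_trans _ _ (4 * r * len n)); last first.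
    rewrite /len exprS le_eqVlt; apply/orP; left; apply/eqP; field.
    by rewrite !expf_neq0 ?pnatr_eq0// gt_eqF.
  by apply: le_trans h; rewrite ler_wpM2r// mulr_ge0// ltW.
rewrite leq_mul2r; apply/orP; right.
by rewrite mulSn -add1n leq_add2r expn_gt0.
Qed.

(** The preceding lemma is used at the finest level where the two cubes are neighbours. Replacing
    its [2 ^ m] by the sum over all such levels gives a bound that can be summed over pairs. *)
Lemma common_bucket_count t u : Q t -> Q u -> lab k t = lab k u ->
  (#|[set tau | bucket (grid tau) t == bucket (grid tau) u]| <=
     C1.+1 * N ^ d.-1 * \sum_(k <= m < n.+1) nbr m t u * 2 ^ m)%N.
Proof.
move=> Qt Qu tu.
have nbrk : nbr k t u by apply/forallP => i; rewrite tu leqnSn.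
have kn1 : (k < n.+1)%N by [].
pose P (m : 'I_n.+1) := (k <= m)%N && nbr m t u.
have Pk : P (Ordinal kn1) by rewrite /P leqnn.
have [m /andP[km nm] mmax] := arg_maxnP (@nat_of_ord n.+1) Pk.
have mn : (m <= n)%N by rewrite -ltnS.
apply: (@leq_trans (C1.+1 * 2 ^ m * N ^ d.-1)).
  apply: common_bucket_count_level => //.
  have [mn1|nm1] := ltnP m n;
    [right; split=> //|by left; apply/eqP; rewrite eqn_leq mn].
  apply/negP => nm1; have mn2 : (m.+1 < n.+1)%N by [].
  have := mmax (Ordinal mn2); rewrite /P nm1 andbT /= => h.
  by have := h (leqW km); rewrite ltnn.
rewrite -mulnA [(2 ^ m * _)%N]mulnC mulnA leq_mul2l; apply/orP; right.
rewrite (bigD1_seq (nat_of_ord m)) ?iota_uniq//=;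
  last by rewrite mem_index_iota km.
by rewrite nm mul1n leq_addr.
Qed.

Lemma bucket_lt z t (B0 : nat) : (2 * b + r) / l0 < B0%:R -> Q t ->
  box_close l0 (p t) z -> (bucket z t < B0 * N)%N.
Proof.
move=> hB Qt tz; have [h1 h2 _] := cap_heightE i0 r0 (ltW l00) l0r tz.
have := pb i0 Qt; rewrite ler_norml => /andP[h3 h4].
have lg := len_gt0 n.
rewrite truncn_lt_nat.
  rewrite ltr_pdivrMr// /len natrM natrX mulrCA -mulrA.
  rewrite divff ?expf_neq0 ?pnatr_eq0// mulr1 mulrC.
  move: hB; rewrite ltr_pdivrMr//; lra.
by rewrite divr_ge0 ?(ltW lg)//; have := r0; lra.
Qed.

(** Double counting of pairs sharing a bucket and a cube of level [k]. For each grid point there are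
    at most [B0 * N * N'] classes, so Cauchy-Schwarz bounds [M ^ 2]. Summing over the [N ^ d] grid
    points, [common_bucket_count] and [nbr_mass] leave [M] times a geometric series of ratio
    [2 * q], and one factor [M] cancels. *)
Lemma bucket_mass_bound (N' B0 : nat) : (2 * b + r) / l0 < B0%:R ->
  (forall z, (forall t, Q t -> box_close l0 (p t) z) -> forall beta,
     (#|[set lab k t | t in [pred t | Q t && (bucket z t == beta)]]| <= N')%N)
       ->
  \sum_t w t <= (B0 * N' * C1.+1 * 3 ^ d)%:R * (2 * q) ^+ k / (1 - 2 * q).
Proof.
move=> hB rich; set M := \sum_t w t.
have M0 : 0 <= M by apply: sumr_ge0.
set bnd := leRHS.
have bnd0 : 0 <= bnd.
  rewrite /bnd divr_ge0//; last by rewrite subr_ge0 ltW.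
  by rewrite mulr_ge0// exprn_ge0// mulr_ge0// ltW.
have [->//|Mn0] := eqVneq M 0.
have Mgt : 0 < M by rewrite lt_def Mn0.
have d_gt0 : (0 < d)%N by rewrite (leq_ltn_trans _ (ltn_ord i0)).
have [t1 Qt1] : exists t, Q t.
  apply/existsP; apply: contraNT Mn0; rewrite negb_exists => /forallP nQ.
  by apply/eqP/big1 => t _; apply: wQ.
have N_gt0 : (0 < N)%N by rewrite expn_gt0.
have B_gt0 : (0 < B0 * N)%N.
  have tau0 : {ffun 'I_d -> 'I_N} := [ffun=> Ordinal N_gt0].
  exact: leq_ltn_trans (bucket_lt hB Qt1 (grid_close tau0 Qt1)).
pose B' := (B0 * N).-1.
have B'E : B'.+1 = (B0 * N)%N by rewrite prednK.
pose c tau t : 'I_B'.+1 * {ffun 'I_d -> 'I_K} :=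
  (inord (bucket (grid tau) t), lab k t).
have bB tau t : Q t -> (bucket (grid tau) t < B'.+1)%N.
  by move=> Qt; rewrite B'E; apply: bucket_lt => //; exact: grid_close.
have cs tau : M ^+ 2 <= (B0 * N * N')%:R * \sum_t \sum_(u | c tau u == c tau t)
  w t * w u.
  have h := @sqr_sum_le_fibers _ _ _ w (c tau) [set c tau t | t in Q] w0.
  apply: le_trans (h _) _.
    move=> t wt; apply: imset_f; apply: contraNT wt => /wQ ->; exact: eqxx.
  rewrite ler_wpM2r//.
    by apply: sumr_ge0 => t _; apply: sumr_ge0 => u _; rewrite mulr_ge0.
  rewrite ler_nat -B'E -[X in (_ <= X * _)%N]card_ord.
  apply: (card_le_fibers (f := fst)) => beta.
  have := rich (grid tau) (fun t Qt => grid_close tau Qt) beta.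
  apply: leq_trans; rewrite -(@card_in_imset _ _ snd).
    apply/subset_leq_card/fintype.subsetP => l /imsetP[a];
      rewrite inE => /andP[/imsetP[t Qt ->]].
    move=> /eqP cb -> /=; apply: imset_f; rewrite inE; apply/andP; split=> //.
    by rewrite -cb /= inordK// bB.
  by move=> [a1 a2] [b1 b2];
    rewrite !inE /= => /andP[_ /eqP ->] /andP[_ /eqP ->] ->.
have pair t u : w t * w u * #|[set tau | c tau u == c tau t]|%:R <=
    (C1.+1 * N ^ d.-1)%:R * \sum_(k <= m < n.+1) 2 ^+ m *
      (w t * ((nbr m u t)%:R * w u)).
  have rhs0 : 0 <= (C1.+1 * N ^ d.-1)%:R * \sum_(k <= m < n.+1) 2 ^+ m *
    (w t * ((nbr m u t)%:R * w u)).
    by rewrite mulr_ge0// sumr_ge0// => m _; rewrite !mulr_ge0// exprn_ge0.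
  have [Qt|/wQ ->] := boolP (Q t);
    last by rewrite !mul0r mulr_ge0// sumr_ge0// => m _; rewrite mul0r mulr0.
  have [Qu|/wQ ->] := boolP (Q u);
    last by rewrite !mulr0 mul0r mulr_ge0// sumr_ge0// => m _; rewrite !mulr0.
  have [tu|tu] := eqVneq (lab k u) (lab k t); last first.
    rewrite (_ : [set _ | _] = finset.set0) ?cards0 ?mulr0//.
    by apply/setP => tau; rewrite !inE /c xpair_eqE (negPf tu) andbF.
  apply: (@le_trans _ _ (w t * w u * (C1.+1 * N ^ d.-1 * \sum_(k <= m < n.+1)
    nbr m u t * 2 ^ m)%:R)).
    rewrite ler_wpM2l ?mulr_ge0// ler_nat.
    apply: leq_trans (common_bucket_count Qu Qt tu).
    apply/subset_leq_card/fintype.subsetP => tau;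
      rewrite !inE /c xpair_eqE tu eqxx andbT.
    by move=> /eqP /(congr1 (@nat_of_ord _)); rewrite !inordK ?bB// => ->.
  rewrite natrM mulrCA ler_wpM2l// natr_sum mulr_sumr ler_sum// => m _.
  by rewrite natrM natrX le_eqVlt; apply/orP; left; apply/eqP; ring.
have dbl : (N ^ d)%:R * M ^+ 2 <= (B0 * N * N')%:R *
    ((C1.+1 * N ^ d.-1)%:R * \sum_(k <= m < n.+1) 2 ^+ m *
      (M * (3 ^+ d * q ^+ m))).
  have -> : (N ^ d)%:R * M ^+ 2 = \sum_(tau : {ffun 'I_d -> 'I_N}) M ^+ 2.
    by rewrite sumr_const card_ffun !card_ord -[RHS]mulr_natl.
  apply: le_trans (ler_sum _ (fun tau _ => cs tau)) _.
  rewrite -mulr_sumr ler_wpM2l//.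
  rewrite exchange_big/=.
  have -> : \sum_t \sum_tau \sum_(u | c tau u == c tau t) w t * w u =
      \sum_t \sum_u w t * w u * #|[set tau | c tau u == c tau t]|%:R.
    apply: eq_bigr => t _; rewrite (exchange_big_dep predT)//=;
      apply: eq_bigr => u _.
    rewrite sumr_const -[LHS]mulr_natr; congr (_ * _%:R); apply: eq_card => tau.
    by rewrite inE.
  apply: le_trans (ler_sum _ (fun t _ => ler_sum _ (fun u _ => pair t u))) _.
  apply: (@le_trans _ _ ((C1.+1 * N ^ d.-1)%:R * \sum_(k <= m < n.+1) 2 ^+ m *
      \sum_t w t * \sum_u (nbr m u t)%:R * w u)).
    rewrite le_eqVlt; apply/orP; left; apply/eqP.
    transitivity ((C1.+1 * N ^ d.-1)%:R * \sum_t \sum_u \sum_(k <= m < n.+1)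
        2 ^+ m * (w t * ((nbr m u t)%:R * w u))).
      rewrite mulr_sumr; apply: eq_bigr => t _; by rewrite mulr_sumr.
    congr (_ * _); under [LHS]eq_bigr do rewrite exchange_big/=.
    rewrite exchange_big/=; apply: eq_bigr => m _.
    rewrite mulr_sumr; apply: eq_bigr => t _.
    by rewrite !mulr_sumr.
  rewrite ler_wpM2l// !big_nat; apply: ler_sum => m /andP[_ mn].
  rewrite ler_wpM2l ?exprn_ge0// mulr_suml; apply: ler_sum => t _.
  rewrite ler_wpM2l//; apply: le_trans (nbr_mass t mn).
  rewrite [leRHS]big_mkcond/=; apply: ler_sum => u _.
  by case: (nbr m u t); rewrite ?mul1r ?mul0r.
have N0 : 0 < (N ^ d)%:R :> R by rewrite ltr0n expn_gt0 N_gt0.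
rewrite -(ler_pM2l Mgt) -(ler_pM2l N0) -expr2; apply: le_trans dbl _.
have -> : \sum_(k <= m < n.+1) 2 ^+ m * (M * (3 ^+ d * q ^+ m)) =
   M * 3 ^+ d * \sum_(k <= m < n.+1) (2 * q) ^+ m.
  by rewrite mulr_sumr; apply: eq_bigr => m _; rewrite exprMn; ring.
have := @geometric_tail_le R (2 * q) k n.+1;
  rewrite q1 mulr_ge0 ?(ltW q0)//= => /(_ isT) g.
rewrite mulrA; apply: le_trans (ler_wpM2l _ (ler_wpM2l _ g)) _.
- by rewrite mulr_ge0.
- by rewrite mulr_ge0// exprn_ge0.
rewrite /bnd -[X in (_ ^ X)%:R](prednK d_gt0) expnS !natrM !natrX.
by rewrite le_eqVlt; apply/orP; left; apply/eqP; ring.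
Qed.

End BucketCount.

(** * Separated points near a common sphere *)

(** More than [N1] of the labels share all their parities. Two distinct ones among these differ by
    at least 2 in some coordinate, so points in their cubes are at least one side apart. *)
Lemma separated_labels (I : finType) (K N1 : nat) (S : {set {ffun I -> 'I_K}}) :
  (2 ^ #|I| * N1 < #|S|)%N ->
  exists g : 'I_N1.+1 -> {ffun I -> 'I_K}, (forall a, g a \in S) /\
    forall a a', a != a' ->
      exists i, ((g a i).+2 <= g a' i)%N \/ ((g a' i).+2 <= g a i)%N.
Proof.
move=> SN; pose par (t : {ffun I -> 'I_K}) : {ffun I -> bool} :=
  [ffun i => odd (t i)].
have [v vN] : exists v, (N1 < #|[set t in S | par t == v]%SET|)%N.
  apply: contrapT => /forallNP nv; move: SN; rewrite ltnNge => /negP; apply.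
  rewrite -card_bool -card_ffun; apply: (card_le_fibers (f := par)) => v.
  by rewrite leqNgt; apply/negP/nv.
pose g (a : 'I_N1.+1) := enum_val (widen_ord vN a).
have gS a : (g a \in S) /\ par (g a) = v.
  by have := enum_valP (widen_ord vN a); rewrite inE => /andP[? /eqP].
exists g; split=> [a|a a' aa']; first by have [] := gS a.
have /eqP gg : g a != g a'.
  apply: contra aa' => /eqP /enum_val_inj /(congr1 (@nat_of_ord _)) /= e.
  exact/eqP/val_inj.
have [i /eqP gi] : exists i, g a i != g a' i.
  apply: contrapT => /forallNP H; apply: gg; apply/ffunP => i.
  by apply/eqP/negPn/negP/H.
exists i; have /ffunP/(_ i) := etrans (gS a).2 (esym (gS a').2); rewrite !ffunE.
have : nat_of_ord (g a i) <> g a' i by move=> /val_inj.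
move: (nat_of_ord (g a i)) (nat_of_ord (g a' i)) => x y; lia.
Qed.

Lemma pigeonhole_sum (R : realFieldType) (K : finType) (D : {set K}) (W : K ->
  R)
    (m : nat) (c : R) : 0 < c -> (#|D| <= m)%N -> c <= \sum_(k in D) W k ->
  exists k, c / m%:R <= W k.
Proof.
move=> c0 Dm cW; apply: contrapT => /forallNP H.
have m0 : (0 < m)%N.
  rewrite (leq_trans _ Dm)// lt0n cards_eq0; apply/eqP => D0.
  by move: cW; rewrite D0 big_set0; lra.
have m0' : 0 < m%:R :> R by rewrite ltr0n.
have [D0|[k0 k0D]] := set_0Vmem D.
  by move: cW; rewrite D0 big_set0; lra.
have : \sum_(k in D) W k < \sum_(k in D) c / m%:R.
  apply: ltr_sum => [|k _]; last by rewrite ltNge; apply/negP/H.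
  by apply/hasP; exists k0; rewrite ?mem_index_enum.
apply/negP; rewrite -leNgt; apply: le_trans cW.
rewrite sumr_const -[leLHS]mulr_natl mulrCA ler_piMr// ?(ltW c0)//.
by rewrite ler_pdivrMr// mul1r ler_nat.
Qed.

(** With [H] the cap height and [t = x i0 + H - F], the quantity to bound is [(t - 2 * H) * t].
    Points of one bucket thus lie near one sphere. *)
Lemma sphere_through_cap (R : archiRcfType) (d : nat) (i0 : 'I_d) (r l0 e F : R)
    (x z : 'I_d -> R) : 0 < r -> 0 <= l0 -> 8 * d%:R * l0 <= r ->
  box_close l0 x z -> `|x i0 + cap_height i0 r x z - F| <= e ->
  `|\sum_i (x i - (if i == i0 then F else z i)) ^+ 2 - r ^+ 2| <= (2 * r + e) *
    e.
Proof.
move=> r0 l00 l0r xz xF; have [h1 h2 h3] := cap_heightE i0 r0 l00 l0r xz.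
rewrite (bigD1 i0)//= eqxx (eq_bigr (fun i => (x i - z i) ^+ 2)); last first.
  by move=> i /negPf ->.
set S := \sum_(i | _) _ in h3 *; set H := cap_height i0 r x z in h1 h2 h3 xF *.
have {h3} -> : (x i0 - F) ^+ 2 + S - r ^+ 2 =
    (x i0 + H - F - 2 * H) * (x i0 + H - F).
  have -> : S = r ^+ 2 - H ^+ 2 by rewrite h3; ring.
  by ring.
rewrite normrM ler_pM// (le_trans (ler_normB _ _))//.
by rewrite [`|2 * H|]ger0_norm; lra.
Qed.

Local Open Scope classical_set_scope.
Local Open Scope ring_scope.

(** * Determined spheres *)

Lemma edist_eqE (R : realType) (d : nat) (x c : 'rV[R]_d) (r : R) : 0 < r ->
  (Defs.edist x c = r) <-> \sum_i (x ord0 i - c ord0 i) ^+ 2 = r ^+ 2.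
Proof.
move=> r0; have s0 : 0 <= \sum_i (x ord0 i - c ord0 i) ^+ 2.
  by apply: sumr_ge0 => i _; exact: sqr_ge0.
rewrite /Defs.edist; split=> [<-|->]; first by rewrite sqr_sqrtr.
by rewrite sqrtr_sqr gtr0_norm.
Qed.

(** The matrix of differences has full column rank, so [d] of its rows form an invertible matrix. *)
Lemma spanning_differences (F : fieldType) (d : nat) (J : finType)
    (p : J -> 'rV[F]_d) (a0 : J) :
  (forall n : 'rV[F]_d, (forall a, \sum_i n ord0 i * (p a ord0 i - p a0 ord0 i)
    = 0) -> n = 0) ->
  exists f : 'I_d -> J, forall n : 'rV[F]_d,
    (forall k, \sum_i n ord0 i * (p (f k) ord0 i - p a0 ord0 i) = 0) -> n = 0.
Proof.
move=> span; pose A := \matrix_(i < #|J|) (p (enum_val i) - p a0).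
have Afull : row_full A.
  apply: contraT => Anf.
  have /matrix0Pn[i0 [j]] : cokermx A != 0.
    rewrite -mxrank_eq0 mxrank_coker subn_eq0 -ltnNge ltn_neqAle rank_leq_col
      andbT.
    exact: Anf.
  suff /matrixP/(_ ord0 i0) : (col j (cokermx A))^T = 0 by rewrite !mxE => ->;
    rewrite eqxx.
  apply: span => a; have /matrixP/(_ (enum_rank a) j) := mulmx_coker A.
  rewrite mxE [RHS in _ = RHS -> _]mxE => /(etrans _); apply;
    apply: eq_bigr => i _.
  by rewrite !mxE enum_rankK mulrC.
exists (fun k => enum_val (fullrankfun Afull k)) => n nf.
have := fullrowsub_unit Afull; set B := rowsub _ _ => Bu.
have Bn : B *m n^T = 0.
  apply/matrixP => k o; rewrite !mxE -[RHS](nf k); apply: eq_bigr => i _.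
  by rewrite !mxE mulrC (ord1 o).
by rewrite -[n]trmxK -[n^T](mulKmx Bu) Bn mulmx0 trmx0.
Qed.

(** For two spheres through the chosen points, subtracting the equations cancels the quadratic terms
    and the radii: the difference of the centres is orthogonal to every [p (f k) - p a0], hence
    zero. *)
Lemma sphere_radius_of_spanning (R : realType) (d : nat) (J : finType)
    (p : J -> 'rV[R]_d) (a0 : J) (c : 'rV[R]_d) (r : R) : 0 < r ->
  (forall a, Defs.edist (p a) c = r) ->
  (forall n : 'rV[R]_d,
    (forall a, \sum_i n ord0 i * (p a ord0 i - p a0 ord0 i) = 0) -> n = 0) ->
  exists x : 'I_d.+1 -> 'rV[R]_d,
    (forall i, exists a, x i = p a) /\ sphere_radius x = r.
Proof.
move=> r0 pc /spanning_differences[f fspan].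
pose x (i : 'I_d.+1) := if unlift ord0 i is Some k then p (f k) else p a0.
have xp i : exists a, x i = p a.
  by rewrite /x; case: unlift => [k|]; [exists (f k)|exists a0].
have xc i : Defs.edist (x i) c = r by have [a ->] := xp i.
have uniq c' r' : 0 < r' -> (forall i, Defs.edist (x i) c' = r') ->
  c' = c /\ r' = r.
  move=> r'0 xc'; suff cc : c' - c = 0.
    have {}cc : c' = c by apply/eqP; rewrite -subr_eq0 cc.
    by split=> //; rewrite -(xc' ord0) cc.
  apply: fspan => k.
  have := (edist_eqE _ _ r0).1 (xc (lift ord0 k)).
  have := (edist_eqE _ _ r0).1 (xc ord0).
  have := (edist_eqE _ _ r'0).1 (xc' (lift ord0 k)).
  have := (edist_eqE _ _ r'0).1 (xc' ord0).
  rewrite /x liftK unlift_none => e1 e2 e3 e4.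
  set u := p (f k) in e2 e4 *; set v := p a0 in e1 e3 *.
  have : 2 * \sum_i (c' - c) ord0 i * (u ord0 i - v ord0 i) =
    (\sum_i (v ord0 i - c' ord0 i) ^+ 2 - \sum_i (u ord0 i - c' ord0 i) ^+ 2) -
    (\sum_i (v ord0 i - c ord0 i) ^+ 2 - \sum_i (u ord0 i - c ord0 i) ^+ 2).
    by rewrite mulr_sumr -!sumrB; apply: eq_bigr => i _; rewrite !mxE; ring.
  rewrite e1 e2 e3 e4; lra.
exists x; split=> //; rewrite /sphere_radius.
set S := [set r | _]; have Sr : S r.
  split=> //; exists c; split; [by exists c, r|exact: xc|].
  move=> S' [c' [r' [r'0 ->]]] /(uniq _ _ r'0)[-> ->] //.
have [r'0 [c' [_ xc' _]]] : S (xget 0 S) by exact: xgetPex (ex_intro _ _ Sr).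
by have [] := uniq _ _ r'0 xc'.
Qed.

(** * Passing to the limit *)

Lemma fmap_ultra (S T : Type) (f : S -> T) (U : set_system S) :
  UltraFilter U -> UltraFilter (f @ U).
Proof.
move=> UU; split; first exact: fmap_proper_filter.
move=> G GG UG; apply/seteqP; split => // B GB.
have [//|nB] := in_ultra_setVsetC (f @^-1` B) UU.
have : G (B `&` ~` B) by apply: filterI => //; apply: UG.
by rewrite setICr => /filter_ex[].
Qed.

Lemma cvg_sumr (R : realType) (T : Type) (U : set_system T) (I : finType)
    (f : T -> I -> R) (l : I -> R) : Filter U ->
  (forall i, f n i @[n --> U] --> l i) ->
  \sum_i f n i @[n --> U] --> \sum_i l i.
Proof.
move=> FU fl; apply: cvg_big => //; exact: add_continuous.
Qed.

(** Along an ultrafilter on [nat] finer than [\oo], compactness makes all points and all coordinates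
    of the centres converge at once, in place of repeated extraction of subsequences. *)
Lemma separated_sphere_limit (R : realType) (d : nat) (J : finType)
    (E : set 'rV[R]_d) (b l r : R) : compact E ->
  (forall e : R, 0 < e -> exists (x : J -> 'rV[R]_d) (c : 'I_d -> R),
    [/\ forall a, E (x a), forall i, `|c i| <= b,
        forall a a', a != a' -> exists i, l <= `|x a ord0 i - x a' ord0 i| &
        forall a, `|\sum_i (x a ord0 i - c i) ^+ 2 - r| <= e]) ->
  exists (x : J -> 'rV[R]_d) (c : 'I_d -> R),
    [/\ forall a, E (x a),
        forall a a', a != a' -> exists i, l <= `|x a ord0 i - x a' ord0 i| &
        forall a, \sum_i (x a ord0 i - c i) ^+ 2 = r].
Proof.
move=> cE approx.
have approxn : forall n : nat, exists (x : J -> 'rV[R]_d) (c : 'I_d -> R),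
    [/\ forall a, E (x a), forall i, `|c i| <= b,
        forall a a', a != a' -> exists i, l <= `|x a ord0 i - x a' ord0 i| &
        forall a, `|\sum_i (x a ord0 i - c i) ^+ 2 - r| <= n.+1%:R^-1].
  by move=> n; apply: approx; rewrite invr_gt0.
have [xs /boolp.choice[cs xcs]] := boolp.choice approxn.
have [U [UU FU]] := @ultraFilterLemma nat \oo _.
have PU : ProperFilter U by exact: ultra_proper.
have cvx : forall a, exists y, E y /\ xs n a @[n --> U] --> y.
  move=> a; move: (cE); rewrite compact_ultra => /(_ ((fun n => xs n a) @ U));
    case; first exact: fmap_ultra.
    by change (U (fun n => E (xs n a))); apply: filterE => n; have [] := xcs n.
  by move=> y [Ey ?]; exists y.
have cvc : forall i : 'I_d, exists y : R, cs n i @[n --> U] --> y.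
  move=> i; have := @segment_compact R (- b) b; rewrite compact_ultra.
  move=> /(_ ((fun n => cs n i) @ U)); case; first exact: fmap_ultra.
    change (U (fun n => cs n i \in `[- b, b])); apply: filterE => n;
      rewrite in_itv/= -ler_norml.
    by have [_ + _ _] := xcs n.
  by move=> y [_ ?]; exists y.
have [x xP] := boolp.choice cvx; have [c cP] := boolp.choice cvc.
have xi a i : xs n a ord0 i @[n --> U] --> x a ord0 i.
  have [_ xa] := xP a.
  exact: (cvg_comp _ _ xa (@coord_continuous R 1 d ord0 i (x a))).
exists x, c; split => [a|a a' aa'|a]; first by have [] := xP a.
(* The separating coordinate may vary with the index, hence the argument by contradiction over all
   coordinates. *)
- apply: contrapT => /forallNP nsep.
  have : \forall n \near U, forall i, `|xs n a ord0 i - xs n a' ord0 i| < l.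
    apply: filter_forall => i; have /negP := nsep i; rewrite -ltNge => lt.
    by apply: cvgr_norm_lt lt; apply: cvgB.
  move=> /filter_ex[n lt]; have [_ _ sep _] := xcs n.
  by have [i] := sep _ _ aa'; rewrite leNgt lt.
- have : \sum_i (xs n a ord0 i - cs n i) ^+ 2 @[n --> U] -->
  \sum_i (x a ord0 i - c i) ^+ 2.
    apply: cvg_sumr => i; rewrite expr2; under eq_fun do rewrite expr2.
    by apply: cvgM; apply: cvgB.
  move=> cv; apply: (norm_cvg_unique cv) => /=.
  apply/cvgrPdist_le => e e0.
  have : \forall n \near U, n.+1%:R^-1 <= e.
    apply: FU; have /cvgrPdist_le/(_ _ e0) := @cvg_harmonic R.
    by apply: filterS => n; rewrite sub0r normrN /= ger0_norm ?invr_ge0.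
  apply: filterS => n; apply: le_trans; rewrite distrC.
  by have [_ _ _] := xcs n.
Qed.

(** * Hausdorff dimension and dyadic cubes *)

Lemma diameter_ge0 (R : realType) (d : nat) (V : set 'rV[R]_d) :
  (0 <= Defs.diameter V)%E.
Proof. by apply: ereal_sup_ubound; left. Qed.

Lemma diameter_le (R : realType) (d : nat) (V : set 'rV[R]_d) (D : R) : 0 <= D
  ->
  (forall x y, V x -> V y -> Defs.edist x y <= D) ->
    (Defs.diameter V <= D%:E)%E.
Proof.
move=> D0 VD; apply: ge_ereal_sup => _ [->|[x Vx [y Vy <-]]]; rewrite lee_fin//.
exact: VD.
Qed.

Lemma diameter_pow_ge0 (R : realType) (d : nat) (s : R) (V : set 'rV[R]_d) :
  (0 <= diameter_pow s V)%E.
Proof. by rewrite /diameter_pow; case: ifP => // _; exact: poweR_ge0. Qed.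

Lemma diameter_pow_le (R : realType) (d : nat) (s D : R) (V : set 'rV[R]_d) :
  0 <= s -> 0 <= D -> (Defs.diameter V <= D%:E)%E ->
  (diameter_pow s V <= (D `^ s)%:E)%E.
Proof.
move=> s0 D0 VD; rewrite /diameter_pow; case: ifP => _.
  by rewrite lee_fin powR_ge0.
by rewrite -poweR_EFin; apply: gt0_ler_poweR => //;
  rewrite in_itv/= leey andbT ?diameter_ge0.
Qed.

Lemma hausdorff_premeasure_ge0 (R : realType) (d : nat) (s delta : R)
    (E : set 'rV[R]_d) : (0 <= hausdorff_premeasure s delta E)%E.
Proof.
apply: le_ereal_inf_tmp => _ [U [_ _ ->]].
by apply: nneseries_ge0 => n _ _; exact: diameter_pow_ge0.
Qed.

(** If every [s > t] gave measure zero, the dimension would be at most [t]; and a nonzero measure, a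
    supremum over [delta], has a positive premeasure. As the latter may be infinite, a real lower
    bound [h] is recorded. *)
Lemma hausdorff_premeasure_gt0 (R : realType) (d : nat) (t : R)
    (E : set 'rV[R]_d) : 0 <= t -> (t%:E < hausdorff_dim E)%E ->
  exists s delta h : R, [/\ t < s, 0 < delta, 0 < h &
    (h%:E <= hausdorff_premeasure s delta E)%E].
Proof.
move=> t0 tE.
have [s [ts Hs]] : exists s, t < s /\ hausdorff_measure s E <> 0%E.
  apply: contrapT => /forallNP H; move: tE; rewrite ltNge => /negP; apply.
  apply/lee_addgt0Pr => e e0; apply: ereal_inf_lbound; exists (t + e) => //.
  split; first by rewrite addr_ge0// ltW.
  by apply: contrapT => He; apply: (H (t + e)); rewrite ltrDl.
have [delta [delta0 Hd]] : exists delta, 0 < delta /\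
  (0 < hausdorff_premeasure s delta E)%E.
  apply: contrapT => /forallNP H; apply: Hs; apply/eqP; rewrite eq_le;
    apply/andP; split.
    apply: ge_ereal_sup => _ [delta /= delta0 <-].
    by rewrite leNgt; apply/negP => h; apply: (H delta).
  apply: le_trans (hausdorff_premeasure_ge0 s 1 E) _.
  by apply: ereal_sup_ubound; exists 1 => //=.
exists s, delta.
have : exists2 h : R, 0 < h & (h%:E <= hausdorff_premeasure s delta E)%E.
  move: Hd; case: hausdorff_premeasure => [h|_|//]; last by exists 1;
    rewrite ?leey.
  by rewrite lte_fin => h0; exists h.
by move=> [h h0 hE]; exists h.
Qed.

(** The cover is continued by empty sets, which contribute 0 by the convention in [diameter_pow]. *)
Lemma hausdorff_premeasure_le_finite_cover (R : realType) (d : nat)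
  (s delta h : R)
    (E : set 'rV[R]_d) (T : finType) (A : {set T}) (V : T ->
      set 'rV[R]_d) (D : T -> R) :
  0 <= s -> 0 <= delta -> (h%:E <= hausdorff_premeasure s delta E)%E ->
  E `<=` \bigcup_(a in [set` A]) V a ->
  (forall a, a \in A -> 0 <= D a <= delta) ->
  (forall a, a \in A -> (Defs.diameter (V a) <= (D a)%:E)%E) ->
  h <= \sum_(a in A) D a `^ s.
Proof.
move=> s0 delta0 hE EV D0 VD.
pose U n := if insub n : option 'I_#|A| is Some i then V (enum_val i) else set0.
have UA (i : 'I_#|A|) : U i = V (enum_val i) by rewrite /U valK.
have U0 n : (#|A| <= n)%N -> U n = set0 by move=> An;
  rewrite /U insubN// -leqNgt.
have diam0 : (Defs.diameter (set0 : set 'rV[R]_d) <= 0%:E)%E by apply: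
  diameter_le.
have : (h%:E <= \sum_(0 <= n <oo) diameter_pow s (U n))%E.
  apply: le_trans hE _; apply: ereal_inf_lbound; exists U; split => //.
    move=> x /EV[a /= aA Vx]; exists (enum_rank_in aA a) => //.
    by rewrite UA enum_rankK_in.
  move=> n; rewrite /U; case: insubP => [i _ _|_].
    have iA := enum_valP i; apply: le_trans (VD _ iA) _.
    by rewrite lee_fin; have /andP[] := D0 _ iA.
  by apply: le_trans diam0 _; rewrite lee_fin.
rewrite (@nneseries_split _ _ 0 #|A|); last by move=> n _;
  exact: diameter_pow_ge0.
rewrite add0n eseries0 ?adde0; last first.
  by move=> i Ai _; rewrite U0// /diameter_pow eqxx.
rewrite big_mkord => hS; rewrite -lee_fin; apply: le_trans hS _.
rewrite (big_enum_val (fun a => D a `^ s)) -sumEFin; apply: lee_sum => i _.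
have iA := enum_valP i; have /andP[? _] := D0 _ iA.
by rewrite UA diameter_pow_le// VD.
Qed.

Lemma edist_le_cube (R : realType) (d : nat) (x y : 'rV[R]_d) (l : R) : 0 <= l
  ->
  (forall i, `|x ord0 i - y ord0 i| <= l) -> Defs.edist x y <= d%:R * l.
Proof.
move=> l0 xyl; rewrite /Defs.edist -(@ger0_norm _ (d%:R * l)) ?mulr_ge0//
  -sqrtr_sqr ler_wsqrtr//.
apply: (@le_trans _ _ (d%:R * l ^+ 2)).
  apply: sum_le_card; first exact: sqr_ge0.
  by move=> j _; rewrite -real_normK ?num_real// ler_sqr ?nnegrE.
rewrite exprMn ler_wpM2r ?sqr_ge0//.
by case: (d) => [|d']; rewrite ?expr0n//= expr2 ler_peMl// ler1n.
Qed.

(** The label of the cube of level [m] containing the cube [t] of level [n]. Division does not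
    increase the entries, so labels of all levels can share one type, as [discrete_frostman]
    expects. *)
Definition ancestor (I : finType) (K n m : nat) (t : {ffun I -> 'I_K}) :
  {ffun I -> 'I_K} :=
  [ffun i => Ordinal (leq_ltn_trans (leq_div (t i) (2 ^ (n - m)))
    (ltn_ord (t i)))].

Lemma ancestor_nested (I : finType) (K n m m' : nat) (t u : {ffun I -> 'I_K}) :
  (m' <= m <= n)%N -> ancestor n m t = ancestor n m u ->
    ancestor n m' t = ancestor n m' u.
Proof.
move=> /andP[m'm mn] /ffunP e; apply/ffunP => i; apply/val_inj => /=.
have := congr1 (@nat_of_ord _) (e i); rewrite !ffunE /= => {}e.
have -> : (n - m' = (n - m) + (m - m'))%N by lia.
by rewrite expnD !divnMA e.
Qed.

Lemma ancestor_itv (R : realFieldType) (I : finType) (K n m : nat)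
    (t : {ffun I -> 'I_K}) (l0 x : R) i : 0 < l0 -> (m <= n)%N ->
  l0 / 2 ^+ n * (t i)%:R <= x < l0 / 2 ^+ n * (t i).+1%:R ->
  l0 / 2 ^+ m * (ancestor n m t i)%:R <= x < l0 / 2 ^+ m *
    (ancestor n m t i).+1%:R.
Proof.
move=> l00 mn /andP[tx xt]; rewrite ffunE /=.
set j := (n - m)%N; have p2 : (0 < 2 ^ j)%N by rewrite expn_gt0.
have -> : l0 / 2 ^+ m = l0 / 2 ^+ n * (2 ^ j)%:R.
  by rewrite -(subnKC mn) exprD natrX -/j; field; rewrite !expf_neq0 ?pnatr_eq0.
have ln0 : 0 < l0 / 2 ^+ n by rewrite divr_gt0// exprn_gt0.
move: (l0 / 2 ^+ n) tx xt ln0 => ln tx xt ln0.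
rewrite -!mulrA -!natrM; apply/andP; split.
  by apply: le_trans tx; rewrite ler_pM2l// ler_nat mulnC leq_divM.
apply: lt_le_trans xt _; rewrite ler_pM2l// ler_nat mulnC.
by rewrite -ltn_divLR.
Qed.

Lemma half_expr_powR (R : realType) (m : nat) (s : R) :
  (2 ^- m) `^ s = (2^-1 `^ s) ^+ m.
Proof.
rewrite -exprVn -!powR_mulrn ?powR_ge0 ?invr_ge0//.
by rewrite -!powRrM mulrC.
Qed.

(** [discrete_frostman] is applied to the cubes of side [l0 / 2 ^ n] that meet [E]. The saturated
    cubes cover [E], and [d] times the side bounds their diameters, so their caps times
    [(d * l0) ^ s] form a covering sum, which is at least [h]. *)
Lemma frostman_on_set (R : realType) (d : nat) (E : set 'rV[R]_d)
    (s delta h b l0 : R) (L n : nat) : 0 <= s -> 0 < l0 -> d%:R * l0 <= delta ->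
  (h%:E <= hausdorff_premeasure s delta E)%E ->
  (forall x i, E x -> `|x ord0 i| < b) -> 2 * b <= l0 * L%:R ->
  exists (w : {ffun 'I_d -> 'I_(L * 2 ^ n)} ->
    R) (p : {ffun 'I_d -> 'I_(L * 2 ^ n)} -> 'rV[R]_d),
  [/\ forall t, 0 <= w t,
      forall t, w t != 0 -> E (p t) /\
        forall i, l0 / 2 ^+ n * (t i)%:R <= p t ord0 i + b < l0 / 2 ^+ n *
          (t i).+1%:R,
      forall m c, (m <= n)%N ->
        \sum_(u | ancestor n m u == c) w u <= (2^-1 `^ s) ^+ m &
      h <= (d%:R * l0) `^ s * \sum_t w t].
Proof.
move=> s0 l00 ld hE Eb bL; pose T := {ffun 'I_d -> 'I_(L * 2 ^ n)}.
have len0 m : 0 < l0 / 2 ^+ m by rewrite divr_gt0// exprn_gt0.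
pose cell (t : T) (x : 'rV[R]_d) := forall i,
  l0 / 2 ^+ n * (t i)%:R <= x ord0 i + b < l0 / 2 ^+ n * (t i).+1%:R.
pose P (t : T) := `[< exists x, E x /\ cell t x >].
have [p pP] : exists p : T -> 'rV[R]_d, forall t, P t ->
  E (p t) /\ cell t (p t).
  have /boolp.choice[p pP] : forall t : T, exists y, P t -> E y /\ cell t y.
    move=> t; have [/asboolP[x ?]|nP] := boolP (P t); first by exists x.
    by exists 0.
  by exists p.
have cap0 m : 0 <= (2^-1 `^ s : R) ^+ m by rewrite exprn_ge0// powR_ge0.
have [w [A [lev [[w0 wP wcap] [AP cover Aw]]]]] :=
  @discrete_frostman R T _ n (@ancestor _ _ n) (fun m => (2^-1 `^ s) ^+ m) P
    cap0
    (fun m m' t u => @ancestor_nested _ _ n m m' t u).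
exists w, p; split=> //.
  by move=> t wt; apply: pP; apply: contraNT wt => /wP ->; rewrite eqxx.
have cover_cell x : E x -> exists2 t : T, P t & cell t x.
  move=> Ex; pose v i := (x ord0 i + b) / (l0 / 2 ^+ n).
  have v0 i : 0 <= v i.
    by rewrite divr_ge0 ?(ltW (len0 n))//; have := Eb x i Ex;
      rewrite ltr_norml; lra.
  have vL i : (Num.truncn (v i) < L * 2 ^ n)%N.
    rewrite truncn_lt_nat// ltr_pdivrMr//.
    have -> : (L * 2 ^ n)%:R * (l0 / 2 ^+ n) = l0 * L%:R.
      by rewrite natrM natrX; field; rewrite expf_neq0 ?pnatr_eq0.
    by apply: lt_le_trans bL; have := Eb x i Ex; rewrite ltr_norml; lra.
  have cx : cell [ffun i => Ordinal (vL i)] x.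
    move=> i; rewrite ffunE/=; have /andP[h1 h2] := truncn_itv (v0 i).
    by rewrite -ler_pdivlMl// -ltr_pdivrMl// ![_^-1 * _]mulrC h1.
  by exists [ffun i => Ordinal (vL i)] => //; apply/asboolP; exists x.
pose V (a : T) : set 'rV[R]_d := [set x | forall i,
   l0 / 2 ^+ lev a * (ancestor n (lev a) a i)%:R <= x ord0 i + b
    < l0 / 2 ^+ lev a * (ancestor n (lev a) a i).+1%:R].
have := @hausdorff_premeasure_le_finite_cover R d s delta h E T A V
  (fun a => d%:R * (l0 / 2 ^+ lev a)) s0.
have lev_le a : l0 / 2 ^+ lev a <= l0.
  by rewrite ler_pdivrMr ?exprn_gt0// ler_peMr ?(ltW l00)// exprn_ege1// ler1n.
have delta0 : 0 <= delta by apply: le_trans ld; rewrite mulr_ge0// ltW.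
move=> /(_ delta0 hE) H; apply: le_trans (H _ _ _) _.
- move=> x /cover_cell[t Pt tx]; have [a aA ta] := cover t Pt.
  exists a => // i; have [_ la] := AP a aA.
  by rewrite -ta; apply: ancestor_itv.
- move=> a _; rewrite mulr_ge0 ?(ltW (len0 _))//=; apply: le_trans ld.
  by rewrite ler_wpM2l.
- move=> a _; apply: diameter_le; first by rewrite mulr_ge0// ltW.
  move=> x y Vx Vy; apply: edist_le_cube; first exact: ltW.
  move=> i; have := Vx i; have := Vy i; rewrite ler_norml.
  rewrite -[(ancestor _ _ _ _).+1%:R]natr1 mulrDr mulr1.
  by move=> /andP[? ?] /andP[? ?]; lra.
rewrite (eq_bigr (fun a => (d%:R * l0) `^ s * (2^-1 `^ s) ^+ lev a)).
  by rewrite -mulr_sumr ler_wpM2l// powR_ge0.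
move=> a _; rewrite mulrA powRM ?mulr_ge0 ?(ltW l00) ?invr_ge0 ?exprn_ge0//.
by rewrite half_expr_powR.
Qed.

(** * Conclusion *)

Lemma half_powR_lt (R : realType) (m : nat) (s : R) :
  m%:R < s -> 2 ^+ m * 2^-1 `^ s < 1.
Proof.
move=> ms; have -> : 2^-1 `^ s = 2 ^- m * 2^-1 `^ (s - m%:R).
  rewrite -exprVn -powR_mulrn ?invr_ge0// -powRD; last first.
    by apply/implyP => _; rewrite invr_eq0.
  by rewrite addrC subrK.
rewrite mulrA divff ?expf_neq0 ?pnatr_eq0// mul1r.
suff : 2^-1 `^ (s - m%:R) < 1 `^ (s - m%:R) :> R by rewrite powR1.
by apply: gt0_ltr_powR; rewrite ?nnegrE ?subr_gt0//; lra.
Qed.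

(** If every bucket met at most [2 ^ d * N1] cubes of level [k], [bucket_mass_bound] would
    contradict the mass of some cube of side [l0]. A richer bucket yields [N1.+1] separated points,
    near one sphere by [sphere_through_cap]. *)
Lemma many_points_near_sphere (R : realType) (d : nat) (E : set 'rV[R]_d)
    (s delta h b l0 r : R) (L : nat) (i0 : 'I_d) :
  1 < s -> 0 < l0 -> 0 < r -> 0 < h -> d%:R * l0 <= delta ->
    8 * d%:R * l0 <= r ->
  (h%:E <= hausdorff_premeasure s delta E)%E ->
  (forall x i, E x -> `|x ord0 i| < b) -> 2 * b <= l0 * L.+1%:R ->
  exists2 C : R, 0 < C & forall k n N1 : nat, (k <= n)%N ->
    N1%:R * (2 * 2^-1 `^ s) ^+ k < C ->
  exists (x : 'I_N1.+1 -> 'rV[R]_d) (c : 'I_d -> R),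
    [/\ forall a, E (x a), forall i, `|c i| <= b + r + l0,
        forall a a', a != a' -> exists i, l0 / 2 ^+ k <= `|x a ord0 i - x a'
          ord0 i| &
        forall a, `|\sum_i (x a ord0 i - c i) ^+ 2 - r ^+ 2| <=
          (2 * r + l0) * (l0 / 2 ^+ n)].
Proof.
move=> s1 l00 r0 h0 ld l0r hE Eb bL.
have d0 : (0 < d)%N by rewrite (leq_ltn_trans _ (ltn_ord i0)).
have dl0 : 0 < (d%:R * l0) `^ s by rewrite powR_gt0// mulr_gt0// ltr0n.
pose q : R := 2^-1 `^ s.
have q0 : 0 < q by rewrite powR_gt0.
have q1 : 2 * q < 1 by exact: (@half_powR_lt _ 1).
pose B0 := (Num.truncn ((2 * b + r) / l0)).+1.
pose C1 := (Num.truncn (8 * r / l0)).+2.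
pose X : R := (B0 * 2 ^ d * C1 * 3 ^ d)%:R.
have X0 : 0 < X by rewrite ltr0n !muln_gt0 !expn_gt0.
have c0 : 0 < h / (d%:R * l0) `^ s by rewrite divr_gt0.
(* The average mass of a cube of side [l0], divided by the constants of [bucket_mass_bound] and by
   the [2 ^ d] lost to parities; it depends on neither [k] nor [n]. *)
exists (h / (d%:R * l0) `^ s / (L.+1 ^ d)%:R * (1 - 2 * q) / X).
  by rewrite divr_gt0// mulr_gt0 ?subr_gt0// divr_gt0// ltr0n expn_gt0.
move=> k n N1 kn; rewrite -/q => N1C.
have [w [p [w0 wp wcap hw]]] := @frostman_on_set R d E s delta h b l0 L.+1 n
  (le_trans ler01 (ltW s1)) l00 ld hE Eb bL.
have {}hw : h / (d%:R * l0) `^ s <= \sum_t w t by rewrite ler_pdivrMr// mulrC.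
pose anc := @ancestor 'I_d (L.+1 * 2 ^ n) n.
have [c1 c1w] : exists c, h / (d%:R * l0) `^ s / (L.+1 ^ d)%:R <=
  \sum_(t | anc 0 t == c) w t.
  pose D := [set anc 0 t | t in {: {ffun 'I_d -> 'I_(L.+1 * 2 ^ n)}}]%SET.
  apply: (@pigeonhole_sum _ _ D (fun c => \sum_(t | anc 0 t == c) w t)) => //.
    pose f (c : {ffun 'I_d -> 'I_(L.+1 * 2 ^ n)}) : {ffun 'I_d -> 'I_L.+1} :=
      [ffun i => inord (c i)].
    rewrite -(@card_in_imset _ _ f).
      by rewrite (leq_trans (max_card _))// card_ffun !card_ord.
    have lt (t : {ffun 'I_d -> 'I_(L.+1 * 2 ^ n)}) i :
      (t i %/ 2 ^ (n - 0) < L.+1)%N.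
      by rewrite subn0 ltn_divLR ?expn_gt0.
    move=> _ _ /imsetP[t _ ->] /imsetP[t' _ ->] /ffunP e.
    apply/ffunP => i; move: (e i);
      rewrite !ffunE /= => /(congr1 (@nat_of_ord _)).
    by rewrite !inordK ?lt// => ?; apply/val_inj.
  apply: le_trans hw _; rewrite (partition_big (anc 0) (mem D))//=.
  by move=> t _; apply: imset_f.
(* Restricting the weight to the cube [c1] preserves the caps and confines the points to a box of
   side [l0]. *)
pose w' t := if anc 0 t == c1 then w t else 0.
pose Q t := (anc 0 t == c1) && (w t != 0).
pose base (i : 'I_d) := l0 * (c1 i)%:R - b.
have QE t : Q t -> E (p t) by move=> /andP[_ /wp[]].
have labP t m i : Q t -> (m <= n)%N ->
    l0 / 2 ^+ m * (anc m t i)%:R <= p t ord0 i + b < l0 / 2 ^+ m *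
      (anc m t i).+1%:R.
  by move=> /andP[_ /wp[_ pt]] mn; apply: ancestor_itv.
have pbase t i : Q t -> base i <= p t ord0 i <= base i + l0.
  move=> Qt; have := labP t 0 i Qt (leq0n _); have /andP[/eqP -> _] := Qt.
  by rewrite expr0 divr1 /base -[(c1 i).+1%:R]natr1 mulrDr mulr1 => /andP[? ?];
    lra.
have w'0 t : 0 <= w' t by rewrite /w'; case: ifP.
have w'Q t : ~~ Q t -> w' t = 0.
  by rewrite /Q /w'; case: eqP => //= _ /negPn/eqP.
have w'cap m c : (m <= n)%N -> \sum_(u | anc m u == c) w' u <= q ^+ m.
  move=> mn; apply: le_trans (wcap m c mn); apply: ler_sum => t _.
  by rewrite /w'; case: ifP.
have pb t i : Q t -> `|p t ord0 i| <= b by move=> /QE Ept; apply/ltW/Eb.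
have [z [zQ [beta many]]] : exists z, (forall t, Q t ->
  box_close l0 (p t ord0) z) /\
    exists beta, (2 ^ d * N1 < #|[set anc k t | t in [pred t | Q t &&
       (bucket i0 r l0 b n (fun t i => p t ord0 i) z t == beta)]]%SET|)%N.
  apply: contrapT => /forallNP H; move: N1C; apply/negP; rewrite -leNgt.
  have := @bucket_mass_bound R d i0 r l0 b _ n k _ Q w' (fun t i => p t ord0 i)
    anc base q
    r0 l00 l0r kn labP pbase w'0 w'Q q0 q1 w'cap pb (2 ^ d * N1) B0
      (truncnS_gt _).
  have -> : \sum_t w' t = \sum_(t | anc 0 t == c1) w t by rewrite
    [RHS]big_mkcond.
  move=> /(_ _)/(le_trans c1w) bnd.
  rewrite ler_pdivrMr// -ler_pdivlMr ?subr_gt0//; apply: le_trans (bnd _) _.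
    move=> z zQ beta; rewrite leqNgt; apply/negP => lt; apply: (H z);
      split => //.
    by exists beta.
  rewrite ler_wpM2r ?invr_ge0 ?subr_ge0 ?(ltW q1)// [leRHS]mulrAC ler_wpM2r
    ?exprn_ge0 ?mulr_ge0 ?(ltW q0)//.
  by rewrite /X -natrM ler_nat; apply/eq_leq; rewrite /C1; ring.
rewrite -[X in (2 ^ X * _ < _)%N]card_ord in many.
have [g [gS gsep]] := separated_labels many.
have ex_f a : exists t, [/\ Q t, anc k t = g a &
    bucket i0 r l0 b n (fun t i => p t ord0 i) z t = beta].
  have /imsetP[t] := gS a; rewrite inE => /andP[Qt /eqP tb] ->.
  by exists t.
have [f fP] := boolp.choice ex_f.
have len0 m : 0 < l0 / 2 ^+ m by rewrite divr_gt0// exprn_gt0.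
have lenl0 : l0 / 2 ^+ n <= l0.
  by rewrite ler_pdivrMr ?exprn_gt0// ler_peMr ?(ltW l00)// exprn_ege1// ler1n.
pose F a := p (f a) ord0 i0 + cap_height i0 r (p (f a) ord0) z.
have FF a : `|F a - F ord0| <= l0 / 2 ^+ n.
  have [Qa _ ba] := fP a; have [Q0 _ b0] := fP ord0.
  apply: (@bucket_dist R d i0 r l0 b n _ Q (fun t i => p t ord0 i) r0 l00 l0r
    pb z) => //.
  - exact: zQ.
  - exact: zQ.
  - by rewrite ba b0.
(* The centre lies above [z] at the height given by the point of index [ord0]; the other points give
   that height up to [l0 / 2 ^ n]. *)
exists (fun a => p (f a)), (fun i => if i == i0 then F ord0 else z i); split.
- by move=> a; have [/QE] := fP a.
- move=> i; have [Q0 _ _] := fP ord0; have z0 := zQ _ Q0.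
  case: ifP => _.
    have [h1 h2 _] := cap_heightE i0 r0 (ltW l00) l0r z0.
    rewrite (le_trans (ler_normD _ _))//.
    rewrite [`|cap_height _ _ _ _|]ger0_norm; last by lra.
    have := pb _ i0 Q0; lra.
  have := z0 i; have := pb _ i Q0; rewrite !ler_norml => /andP[? ?] /andP[? ?].
  apply/andP; split; lra.
- move=> a a' /gsep[i gi]; exists i.
  have [Qa ga _] := fP a; have [Qa' ga' _] := fP a'.
  have := labP _ k i Qa kn; have := labP _ k i Qa' kn; rewrite ga ga'.
  rewrite -[(g a i).+1%:R]natr1 -[(g a' i).+1%:R]natr1 !mulrDr !mulr1.
  have lk := len0 k; move: (l0 / 2 ^+ k) lk => lk lk0 /andP[t1 t2] /andP[u1 u2].
  case: gi => gi.
    have : (g a i)%:R + 2 <= (g a' i)%:R :> R by rewrite -natrD ler_nat addn2.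
    move=> /(ler_wpM2l (ltW lk0)); rewrite mulrDr => h1.
    by rewrite distrC ger0_norm; lra.
  have : (g a' i)%:R + 2 <= (g a i)%:R :> R by rewrite -natrD ler_nat addn2.
  move=> /(ler_wpM2l (ltW lk0)); rewrite mulrDr => h1.
  by rewrite ger0_norm; lra.
- move=> a; have [Qa _ _] := fP a.
  apply: le_trans (sphere_through_cap r0 (ltW l00) l0r (zQ _ Qa) (FF a)) _.
  by rewrite ler_wpM2r ?(ltW (len0 n))// lerD2l.
Qed.

Lemma compact_coord_bounded (R : realType) (d : nat) (E : set 'rV[R]_d) :
  compact E -> exists2 b : R, 0 < b & forall x i, E x -> `|x ord0 i| < b.
Proof.
move=> /compact_bounded[M [_ /(_ (M + 1))]]; rewrite ltrDl ltr01 => /(_ isT) EM.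
exists (`|M + 1| + 1); first by rewrite ltr_wpDl.
move=> x i Ex; rewrite (@le_lt_trans _ _ (M + 1))//;
  last by rewrite (le_lt_trans (ler_norm _))// ltrDl.
apply: le_trans (EM _ Ex); rewrite [leRHS]/Num.norm /= mx_normrE.
by apply/bigmax_geP; right => /=; exists (ord0, i).
Qed.

(** The expression is [B0 * A0 ^ m * (2 ^ m * q) ^ k], geometric in [k] with ratio below 1. *)
Lemma polynomial_geometric_small (R : realType) (C q : R) (A0 B0 m : nat) :
  0 < C -> 0 < q -> 2 ^+ m * q < 1 ->
  exists k : nat, (B0 * (A0 * 2 ^ k) ^ m)%:R * q ^+ k < C.
Proof.
move=> C0 q0 q1; have /cvgrPdist_lt/(_ _ C0)[k _ Hk] : @geometric R
  (B0 * A0 ^ m)%:R (2 ^+ m * q) @ \oo --> 0.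
  by apply: cvg_geometric; rewrite gtr0_norm// mulr_gt0// exprn_gt0.
exists k; have := Hk k (leqnn k); rewrite sub0r normrN /= => H.
apply: le_lt_trans H; apply: le_trans (ler_norm _).
have -> : ((A0 * 2 ^ k) ^ m = A0 ^ m * (2 ^ m) ^ k)%N.
  by rewrite expnMn -!expnM [(k * m)%N]mulnC.
by rewrite exprMn mulnA [leLHS]mulrC natrM mulrCA [q ^+ k * _]mulrC mulrA
  !natrX -mulrA.
Qed.

Unset Implicit Arguments.
Set Strict Implicit.
Set Printing Implicit Defensive.

Theorem mainTheorem3 (R : realType) (d : nat) (hd : (2 <= d)%N)
    (E : set 'rV[R]_d) (hE : compact E)
    (hdim : ((d%:R - 1)%:E < hausdorff_dim E)%E) :
  forall r : R, 0 < r ->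
    exists x : 'I_d.+1 -> 'rV[R]_d,
      (forall i, E (x i)) /\ sphere_radius x = r.
Proof.
move=> r r0; have d0 : 0 < d%:R :> R by rewrite ltr0n; lia.
have d1 : 1 <= d%:R - 1 :> R by have : 2 <= d%:R :> R; [rewrite ler_nat|lra].
have [s [delta [h [ds delta0 h0 hE']]]] :=
  hausdorff_premeasure_gt0 (le_trans ler01 d1) hdim.
have [b b0 Eb] := compact_coord_bounded hE.
have i0 : 'I_d := Ordinal (ltnW hd).
(* Small enough for the transversality estimates and for cubes of side [l0] to have diameter at most
   [delta]. *)
pose l0 := Num.min (r / (8 * d%:R)) (delta / d%:R).
have l00 : 0 < l0 by rewrite lt_min !divr_gt0// mulr_gt0.
have ld : d%:R * l0 <= delta by rewrite mulrC -ler_pdivlMr// ge_min lexx orbT.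
have l0r : 8 * d%:R * l0 <= r by rewrite mulrC -ler_pdivlMr ?mulr_gt0// ge_min
  lexx.
have bL : 2 * b <= l0 * (Num.truncn (2 * b / l0)).+1%:R.
  by rewrite [leRHS]mulrC -ler_pdivrMr//; exact/ltW/truncnS_gt.
have [C C0 many] := many_points_near_sphere i0 (le_lt_trans d1 ds) l00 r0 h0 ld
  l0r hE' Eb bL.
(* [A0 * 2 ^ k] exceeds the grid size [4 * d ^ 2 * b / (l0 / 2 ^ k)] in
   [sphere_hyperplane_packing]. *)
pose A0 := (Num.truncn (4 * d%:R ^+ 2 * b / l0)).+1.
have q0 : 0 < 2^-1 `^ s :> R by rewrite powR_gt0.
(* The dimension hypothesis enters here, through [s > d - 1]. *)
have qd : 2 ^+ (d - 2) * (2 * 2^-1 `^ s) < 1 :> R.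
  rewrite mulrA -exprSr; apply: half_powR_lt; apply: le_lt_trans ds.
  have : d%:R = (d - 2)%:R + 2 :> R by rewrite -natrD subnK.
  by rewrite -[_.+1%:R]natr1; lra.
(* [k] is fixed so that the packing bound [N1] is admissible in [many]; then [N1.+1] separated
   points are too many for a hyperplane section. *)
have [k kC] := @polynomial_geometric_small R C _ A0 (d * 2) (d - 2) C0
  (mulr_gt0 (ltr0n R 2) q0) qd.
set N1 := (d * 2 * _)%N in kC.
have lk0 : 0 < l0 / 2 ^+ k by rewrite divr_gt0// exprn_gt0.
have approx e : 0 < e -> exists (x : 'I_N1.+1 -> 'rV[R]_d) (c : 'I_d -> R),
    [/\ forall a, E (x a), forall i, `|c i| <= b + r + l0,
        forall a a', a != a' -> exists i, l0 / 2 ^+ k <= `|x a ord0 i - x a'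
          ord0 i| &
        forall a, `|\sum_i (x a ord0 i - c i) ^+ 2 - r ^+ 2| <= e].
  (* With [k] fixed, [n] makes the error [(2 * r + l0) * l0 / 2 ^ n] at most [e]. *)
  move=> e0; pose n := maxn k (Num.truncn ((2 * r + l0) * l0 / e)).+1.
  have [x [c [xE cb xs xr]]] := many k n N1 (leq_maxl _ _) kC.
  exists x, c; split => // a; apply: le_trans (xr a) _.
  rewrite mulrA ler_pdivrMr ?exprn_gt0// [leRHS]mulrC -ler_pdivrMr//.
  rewrite (le_trans (ltW (truncnS_gt _)))// -natrX ler_nat.
  by rewrite (leq_trans (leq_maxr k _))// ltnW// ltn_expl.
have [x [c [xE xsep xc]]] := separated_sphere_limit hE approx.
have [|n xn|y [yx yr]] :=
  @sphere_radius_of_spanning R d _ x ord0 (\row_i c i) r r0.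
- move=> a; apply/edist_eqE => //; rewrite -(xc a).
  by apply: eq_bigr => i _; rewrite mxE.
(* A nonzero [n] would be normal to a hyperplane containing all the points, against the packing
   bound. *)
- apply: contrapT => n0.
  have A0k : (0 < A0 * 2 ^ k)%N by rewrite muln_gt0 expn_gt0.
  suff : (#|'I_N1.+1| <= d * 2 * (A0 * 2 ^ k).-1.+1 ^ (d - 2))%N.
    by rewrite prednK// card_ord ltnn.
  apply: (@sphere_hyperplane_packing R d _ (fun a => x a ord0) (n ord0) c
    (\sum_i n ord0 i * x ord0 ord0 i) (r ^+ 2) (l0 / 2 ^+ k) b) => //.
  + by apply: contrapT => /forallNP n0'; apply: n0; apply/rowP => i;
      rewrite mxE; apply/eqP/negPn/negP/n0'.
  + move=> a; apply/eqP; rewrite -subr_eq0 -sumrB -[X in _ == X](xn a).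
    by apply/eqP/eq_bigr => i _; rewrite mulrBr.
  + by move=> a i; apply/ltW/Eb.
  + rewrite prednK// natrM natrX invf_div mulrA.
    by rewrite mulrAC ltr_pM2r ?exprn_gt0//; exact: truncnS_gt.
by exists y; split => // i; have [a ->] := yx i.
Qed.
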